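(* The problems \textsc{Sum}-$k$-\textsc{DMC} and \textsc{Cov}-$k$-\textsc{DMC} can be solved in strongly polynomial time.
   Context: Let $G=(V,E)$ be a finite directed graph with distinct vertices $s,t\in V$. An $s$-$t$ cut is a set $X\subseteq E$ such that removing $X$ leaves no directed path from $s$ to $t$; a minimum $s$-$t$ cut is an $s$-$t$ cut of minimum cardinality, and $\Gamma_G(s,t)$ denotes the set of all minimum $s$-$t$ cuts of $G$. For a tuple/multiset $(X_1,\dots,X_k)$ of subsets of $E$ define the pairwise-sum diversity $d_{\mathrm{sum}}(X_1,\dots,X_k)=\sum_{1\le i<j\le k}|X_i\triangle X_j|$ and the coverage diversity $d_{\mathrm{cov}}(X_1,\dots,X_k)=\left|\bigcup_{i=1}^k X_i\right|$, where $\triangle$ is symmetric difference. The problem $k$-\textsc{Diverse Minimum $s$-$t$ Cuts} with diversity measure $d$: given $G$, $s,t$, and an integer $k>0$, letting $U_k$ be the set of $k$-element multisets of elements of $\Gamma_G(s,t)$, find $C\in U_k$ with $d(C)=\max_{S\in U_k}d(S)$. \textsc{Sum}-$k$-\textsc{DMC} is this problem with $d=d_{\mathrm{sum}}$ and \textsc{Cov}-$k$-\textsc{DMC} is this problem with $d=d_{\mathrm{cov}}$. *)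

(* Defs.v *)
From mathcomp Require Import all_boot.
Set Implicit Arguments. Unset Strict Implicit. Unset Printing Implicit Defensive.

(* A finite directed graph is given by n vertices 0..n-1 and a duplicate-free
   list E of arcs (u,v).  Arcs are identified by their index i : 'I_(size E);
   an edge set X ⊆ E is a {set 'I_(size E)}. *)

Definition arc (E : seq (nat * nat)) (i : nat) : nat * nat := nth (0, 0) E i.

Definition avail (E : seq (nat * nat)) (X : {set 'I_(size E)}) : rel nat :=
  fun u v => [exists i : 'I_(size E), (i \notin X) && (arc E i == (u, v))].

Definition reach (E : seq (nat * nat)) (X : {set 'I_(size E)}) (s t : nat) : Prop :=
  exists p : seq nat, path (avail X) s p /\ last s p = t.

Definition is_st_cut (E : seq (nat * nat)) (s t : nat) (X : {set 'I_(size E)}) : Prop :=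
  ~ reach X s t.

Definition is_min_st_cut (E : seq (nat * nat)) (s t : nat) (X : {set 'I_(size E)}) : Prop :=
  is_st_cut s t X /\ forall Y : {set 'I_(size E)}, is_st_cut s t Y -> #|X| <= #|Y|.

Definition symdiff (T : finType) (A B : {set T}) : {set T} := (A :\: B) :|: (B :\: A).

(* a k-element multiset of subsets is represented as a sequence of length k;
   both measures are invariant under reordering *)
Definition d_sum (T : finType) (C : seq {set T}) : nat :=
  \sum_(i < size C) \sum_(j < size C | i < j)
     #|symdiff (nth set0 C i) (nth set0 C j)|.

Definition d_cov (T : finType) (C : seq {set T}) : nat :=
  #|\bigcup_(X <- C) X|.

Definition diversity := forall T : finType, seq {set T} -> nat.

Definition optimal_dmc (d : diversity) (E : seq (nat * nat)) (s t k : nat)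
    (C : seq {set 'I_(size E)}) : Prop :=
  [/\ size C = k,
      (forall X, X \in C -> is_min_st_cut s t X) &
      forall D : seq {set 'I_(size E)},
        size D = k -> (forall X, X \in D -> is_min_st_cut s t X) ->
        d _ D <= d _ C].

(* Registers R[0], R[1], ... hold natural numbers.  Arithmetic operations
   (+, truncated -, *, div) and comparisons cost one step each; indirect
   addressing is available. *)
Inductive instr :=
| IConst of nat & nat
| IAdd   of nat & nat & nat
| ISub   of nat & nat & nat
| IMul   of nat & nat & nat
| IDiv   of nat & nat & nat
| ILoad  of nat & nat
| IStore of nat & nat
| IJz    of nat & nat
| IJmp   of nat
| IHalt.

Definition program := seq instr.

Record state := St { pc : nat; mem : nat -> nat }.

Definition upd (m : nat -> nat) (a v : nat) : nat -> nat :=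
  fun x => if x == a then v else m x.

Definition instr_at (P : program) (l : nat) : instr := nth IHalt P l.

Definition halted (P : program) (st : state) : bool :=
  if instr_at P (pc st) is IHalt then true else false.

Definition step (P : program) (st : state) : state :=
  let: St l m := st in
  match instr_at P l with
  | IConst r c => St l.+1 (upd m r c)
  | IAdd r a b => St l.+1 (upd m r (m a + m b))
  | ISub r a b => St l.+1 (upd m r (m a - m b))
  | IMul r a b => St l.+1 (upd m r (m a * m b))
  | IDiv r a b => St l.+1 (upd m r (m a %/ m b))
  | ILoad r a => St l.+1 (upd m r (m (m a)))
  | IStore a r => St l.+1 (upd m (m a) (m r))
  | IJz r l' => if m r == 0 then St l' m else St l.+1 m
  | IJmp l' => St l' m
  | IHalt => St l m
  end.

Definition run (P : program) (j : nat) (st : state) : state := iter j (step P) st.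

Definition encode (n s t k : nat) (E : seq (nat * nat)) : seq nat :=
  [:: n; s; t; k; size E] ++ flatten [seq [:: e.1; e.2] | e <- E].

Definition init_state (inp : seq nat) : state := St 0 (fun a => nth 0 inp a).

Definition decode (E : seq (nat * nat)) (k : nat) (m : nat -> nat)
    : seq {set 'I_(size E)} :=
  [seq [set i : 'I_(size E) | m (j * size E + i) != 0] | j <- iota 0 k].

Definition valid_instance (n s t k : nat) (E : seq (nat * nat)) : Prop :=
  [/\ s < n, t < n, s != t, 0 < k &
      uniq E /\ all (fun e : nat * nat => (e.1 < n) && (e.2 < n)) E].

(* Strongly polynomial solvability: a fixed RAM program that, on every valid
   instance, halts within a number of steps polynomial in n + |E| + k (the
   number of items of input and output), all intermediate numbers having
   bit length polynomial in the same quantity, and outputs an optimal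
   solution. *)
Definition strongly_poly_solvable (d : diversity) : Prop :=
  exists (P : program) (c : nat),
    forall n s t k (E : seq (nat * nat)),
      valid_instance n s t k E ->
      let N := n + size E + k in
      let st0 := init_state (encode n s t k E) in
      exists T : nat,
        [/\ T <= c * N.+1 ^ c,
            halted P (run P T st0),
            (forall j a, j <= T -> mem (run P j st0) a < 2 ^ (c * N.+1 ^ c)) &
            optimal_dmc d s t k (decode E k (mem (run P T st0)))].

(* Main.v *)
(* The layered graph has nodes (v, i) with i < k and, for every arc (u, v) and shift
   j < k, arcs (u, i) -> (v, i + j) of capacity a_j.  A k-tuple of min cuts D is read as
   the potential pi(v) = number of indices i such that v is cut off from s by D_i, and
   the threshold set { (v, i) : pi(v) <= i } has capacity at most
   sum_e sum_j a_j (mult_D(e) - j)^+.  Conversely the layers of a minimum cut of the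
   layered graph are k cuts of the original graph.  With a_0 large they must be minimum
   cuts, and the remaining weights a_j (1 for all j >= 1, resp. for j = 1 only) make
   sum_e C(mult(e), 2), resp. sum_e (mult(e) - 1)^+, as small as possible; as
   sum_e mult(e) is the same for all k-tuples of min cuts, this is the maximization of
   d_sum, resp. d_cov.  So a single maximum flow computation with polynomially bounded
   integral capacities suffices.

   The augmenting path algorithm is written in a small language whose loops are bounded
   by read-only variables, so that its running time is bounded by induction on the
   syntax.  Its only products have a read-only variable or a constant as second factor;
   hence every machine step multiplies the largest stored number by at most a fixed
   polynomial bound G, and a polynomial number of steps yields polynomial bit length. *)
From mathcomp Require Import all_boot zify.
From Stdlib Require Import ClassicalEpsilon.
Require Import Defs.
Set Implicit Arguments. Unset Strict Implicit. Unset Printing Implicit Defensive.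

(** * Diverse minimum cuts as a layered minimum cut *)

(** The two halves of the comparison do not match literally. From below, a layered cut is only known
    to cost the excess of the level differences, and these may be smaller than the multiplicities
    that determine the diversity, since the layers of a minimum cut are not assumed to be nested.
    The gap is closed by counting: the sets of vertices of level at most i, for i < k, are k cuts,
    so the truncated level differences add up to at least k times the minimum cut size. The
    multiplicities, which bound them, add up to exactly that, so the two agree on every arc. The
    augmenting path part needs neither flows nor a duality theorem. Its invariant says that, for
    every S containing all copies of s and none of t, the residual cut of S plus the number of
    augmentations is the original cut of S. When the search is stuck, the visited set has residual
    cut 0, so it is a minimum. *)

Lemma sum_geq_diff k (P Q : nat -> bool) j :
  (\sum_(i < k) Q i - \sum_(i < k) P i) - j <=
  \sum_(i < k) ((i + j < k) && (~~ P i && Q (i + j))).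
Proof.
have [jk|kj] := leqP j k; last first.
  have : \sum_(i < k) Q i <= k.
    rewrite -[leqRHS]card_ord -sum1_card; apply: leq_sum => i _; exact: leq_b1.
  by lia.
rewrite leq_subLR leq_subLR.
have {1}-> : \sum_(i < k) Q i = \sum_(0 <= i < k) Q i by rewrite big_mkord.
(* The first j positions contribute at most j to the sum of Q; a later position i + j satisfying Q
   either has P i or is counted on the right. *)
rewrite (big_cat_nat (n := j)) //= addnCA leq_add //.
  apply: (@leq_trans (\sum_(0 <= i < j) 1)).
    by apply: leq_sum => i _; exact: leq_b1.
  by rewrite sum_nat_const_nat; lia.
rewrite -big_split /= -{1}[j]add0n big_addn.
apply: (@leq_trans (\sum_(0 <= i < k - j) (P i + ((i + j < k) && (~~ P i && Q (i + j)))))).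
  rewrite !big_nat; apply: leq_sum => i /andP[_ hi].
  have -> : i + j < k by lia.
  by case: (P i); case: (Q _).
rewrite -(big_mkord xpredT (fun i => P i + ((i + j < k) && (~~ P i && Q (i + j))))).
rewrite (big_cat_nat (n := k - j) (p := k)) //=; last exact: leq_subr.
exact: leq_addr.
Qed.

(** The indices counted are those from a up to [minn k (b - j)], exclusive. *)
Lemma sum_threshold k a b j :
  \sum_(i < k) ((a <= i) && (i + j < b)) <= b - a - j.
Proof.
apply: (@leq_trans (minn k (b - j) - a)); last by lia.
elim: k => [|k IH]; first by rewrite big_ord0.
by rewrite big_ord_recr /=; move: IH; set X := \sum_(_ < _) _; case: (leqP a k); case: (ltnP (k + j) b) => /=; lia.
Qed.

Definition boundary (E : seq (nat * nat)) (S : nat -> bool) : {set 'I_(size E)} :=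
  [set e : 'I_(size E) | S (arc E e).1 && ~~ S (arc E e).2].

Lemma boundary_cut E s t (S : nat -> bool) :
  S s -> ~~ S t -> is_st_cut s t (boundary E S).
Proof.
move=> Ss St [p [hp lp]]; move: St; rewrite -lp; apply/negP; rewrite negbK.
elim: p s Ss hp {lp} => //= v p IH s Ss /andP[/existsP[e /andP[+ /eqP he]] hp].
rewrite inE he /= Ss /= negbK => Sv; exact: IH hp.
Qed.

(* The witness is the set of vertices reachable from [s]. *)
Lemma cut_boundary E s t (X : {set 'I_(size E)}) :
  is_st_cut s t X ->
  exists S : nat -> bool, [/\ S s, ~~ S t & boundary E S \subset X].
Proof.
move=> cutX.
pose S v : bool := if excluded_middle_informative (reach X s v) then true else false.
have SP v : reflect (reach X s v) (S v).
  by rewrite /S; case: excluded_middle_informative => h; constructor.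
exists S; split; first by apply/SP; exists [::].
  by apply/SP.
apply/subsetP => e; rewrite inE => /andP[/SP[p [hp lp]] /SP nr].
apply/negPn/negP => eX; apply: nr; exists (rcons p (arc E e).2).
rewrite last_rcons rcons_path hp lp; split=> //=.
by apply/existsP; exists e; rewrite eX /=; apply/eqP; case: (arc E e).
Qed.

Lemma exists_min_cut E s t : s != t ->
  exists X : {set 'I_(size E)}, is_min_st_cut s t X.
Proof.
move=> st.
pose C (X : {set 'I_(size E)}) : bool :=
  if excluded_middle_informative (is_st_cut s t X) then true else false.
have CP X : reflect (is_st_cut s t X) (C X).
  by rewrite /C; case: excluded_middle_informative => h; constructor.
(* The set of all arcs is a cut, because s != t rules out the empty path. *)
have CT : C setT.
  apply/CP => -[[|v p] [/= hp lp]]; first by rewrite lp eqxx in st.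
  by case/andP: hp => /existsP[e]; rewrite inE.
case: (arg_minnP (fun X : {set 'I_(size E)} => #|X|) CT) => X /CP cX minX.
by exists X; split=> // Y /CP; exact: minX.
Qed.

(** * Both diversities as sums over multiplicities *)

Definition mult (T : finType) (C : seq {set T}) (e : T) : nat :=
  \sum_(i < size C) (e \in nth set0 C i).

Lemma card_set_sum (T : finType) (A : {set T}) : #|A| = \sum_e (e \in A).
Proof. by rewrite -sum1_card big_mkcond; apply: eq_bigr => e _; case: (_ \in _). Qed.

Lemma mult_le (T : finType) (C : seq {set T}) e : mult C e <= size C.
Proof.
rewrite -[leqRHS]card_ord -sum1_card; apply: leq_sum => i _; exact: leq_b1.
Qed.

Lemma sum_mult (T : finType) (C : seq {set T}) :
  \sum_e mult C e = \sum_(i < size C) #|nth set0 C i|.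
Proof.
rewrite exchange_big; apply: eq_bigr => i _.
by rewrite card_set_sum.
Qed.

Lemma card_symdiff (T : finType) (A B : {set T}) :
  #|symdiff A B| = \sum_e ((e \in A) (+) (e \in B)).
Proof.
rewrite card_set_sum; apply: eq_bigr => e _.
by rewrite !inE; case: (e \in A); case: (e \in B).
Qed.

Lemma sum_pairs k (F : 'I_k -> 'I_k -> nat) :
  (forall i j, F i j = F j i) -> (forall i, F i i = 0) ->
  2 * \sum_(i < k) \sum_(j < k | i < j) F i j = \sum_(i < k) \sum_(j < k) F i j.
Proof.
move=> sym diag; rewrite mul2n -addnn.
have {2}-> : \sum_(i < k) \sum_(j < k | i < j) F i j =
         \sum_(i < k) \sum_(j < k | j < i) F i j.
  rewrite (exchange_big_dep xpredT) //=; apply: eq_bigr => i _.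
  by apply: eq_bigr => j _.
rewrite -big_split; apply: eq_bigr => i _ /=.
rewrite [RHS](bigID (fun j : 'I_k => i < j)) /=; congr (_ + _).
rewrite [RHS](bigID (fun j : 'I_k => j == i)) /= [X in _ = X + _]big1; last first.
  by move=> j /andP[_ /eqP->].
by apply: eq_bigl => j; rewrite -leqNgt ltn_neqAle andbC.
Qed.

(** An element lying in mu of the k sets separates exactly mu (k - mu) pairs. The proof counts
    ordered pairs, hence each pair twice. *)
Lemma d_sumE (T : finType) (C : seq {set T}) :
  d_sum C = \sum_e mult C e * (size C - mult C e).
Proof.
apply/eqP; rewrite -(eqn_pmul2l (isT : 0 < 2)); apply/eqP.
rewrite /d_sum sum_pairs; first last.
- by move=> i; rewrite card_symdiff big1 // => e _; rewrite addbb.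
- by move=> i j; rewrite /symdiff setUC.
transitivity (\sum_(i < size C) \sum_e \sum_(j < size C)
    ((e \in nth set0 C i) (+) (e \in nth set0 C j))).
  apply: eq_bigr => i _; rewrite exchange_big /=; apply: eq_bigr => j _.
  exact: card_symdiff.
rewrite exchange_big big_distrr /=; apply: eq_bigr => e _.
set b := fun i => e \in nth set0 C i.
have row i : \sum_(j < size C) (b i (+) b j) =
    if b i then size C - mult C e else mult C e.
  case: (b i); last by apply: eq_bigr.
  apply/eqP; rewrite -(eqn_add2r (mult C e)) subnK ?mult_le // -big_split /=.
  rewrite -[eqbRHS]card_ord -sum1_card; apply/eqP/eq_bigr => j _.
  by rewrite /b; case: (_ \in _).
transitivity (\sum_(i < size C) (b i * (size C - mult C e) + ~~ b i * mult C e)).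
  by apply: eq_bigr => i _; rewrite row; case: (b i); rewrite ?mul1n ?mul0n ?addn0.
rewrite big_split /= -!big_distrl /= -/(mult C e).
have -> : \sum_(i < size C) ~~ b i = size C - mult C e.
  apply/eqP; rewrite -(eqn_add2l (mult C e)) subnKC ?mult_le // -big_split /=.
  rewrite -[eqbRHS]card_ord -sum1_card; apply/eqP/eq_bigr => j _.
  by rewrite /b; case: (_ \in _).
by lia.
Qed.

Lemma d_covE (T : finType) (C : seq {set T}) :
  d_cov C = \sum_e (0 < mult C e).
Proof.
rewrite /d_cov card_set_sum; apply: eq_bigr => e _; congr nat_of_bool.
rewrite (big_nth set0) big_mkord lt0n sum_nat_eq0 negb_forall.
apply/bigcupP/existsP => [[i _ he]|[i]].
  by exists i; rewrite he.
by case he: (e \in _) => // _; exists i.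
Qed.

(* Capacity of the cut S in the graph on the nodes (v, i), i < k, in which an arc
   e = (u, v) gives arcs of capacity [a j] from (u, i) to (v, i + j). *)
Definition layered_cut (a : nat -> nat) (k : nat) (E : seq (nat * nat))
    (S : nat -> nat -> bool) : nat :=
  \sum_(e < size E) \sum_(i < k) \sum_(j < k)
    (i + j < k) * (a j * (S (arc E e).1 i && ~~ S (arc E e).2 (i + j))).

Definition layered_sol (k : nat) (E : seq (nat * nat)) (S : nat -> nat -> bool) :
    seq {set 'I_(size E)} :=
  mkseq (fun i => boundary E (S^~ i)) k.

Definition level (k : nat) (S : nat -> nat -> bool) (v : nat) : nat :=
  \sum_(i < k) ~~ S v i.

Definition excess (b : nat -> nat) (k mu : nat) : nat :=
  \sum_(j < k | 0 < j) b j * (mu - j).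

Lemma excess_le b k mu nu : mu <= nu -> excess b k mu <= excess b k nu.
Proof. by move=> h; apply: leq_sum => j _; apply: leq_mul => //; lia. Qed.

Lemma level_diff k S u v j :
  level k S v - level k S u - j <=
  \sum_(i < k) (i + j < k) * (S u i && ~~ S v (i + j)).
Proof.
apply: leq_trans (sum_geq_diff k (fun i => ~~ S u i) (fun i => ~~ S v i) j) _.
by apply: leq_sum => i _; rewrite negbK; case: (i + j < k); rewrite ?mul1n.
Qed.

Lemma mult_layered k E S e :
  mult (layered_sol k E S) e =
  \sum_(i < k) (S (arc E e).1 i && ~~ S (arc E e).2 i).
Proof.
rewrite /mult size_mkseq; apply: eq_bigr => i _.
by rewrite nth_mkseq // inE.
Qed.

Lemma sum_split0 k (F : 'I_k -> nat) (k0 : 0 < k) :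
  \sum_(j < k) F j = F (Ordinal k0) + \sum_(j < k | 0 < j) F j.
Proof.
rewrite (bigD1 (Ordinal k0)) //=; congr (_ + _); apply: eq_bigl => j.
by rewrite lt0n.
Qed.

(** Shift 0 recovers the multiplicities exactly, whereas a shift j > 0 is controlled only by the
    difference of levels. The two quantities are reconciled in [layered_sol_main]. *)
Lemma layered_cut_geq a k E S : 0 < k ->
  a 0 * (\sum_e mult (layered_sol k E S) e) +
  \sum_(e < size E) excess a k (level k S (arc E e).2 - level k S (arc E e).1) <=
  layered_cut a k E S.
Proof.
move=> k0; rewrite /layered_cut big_distrr -big_split /=; apply: leq_sum => e _.
rewrite exchange_big /= (sum_split0 _ k0) /=; apply: leq_add.
  rewrite mult_layered big_distrr /=; apply: leq_sum => i _.
  by rewrite addn0 ltn_ord mul1n.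
apply: leq_sum => j _.
apply: leq_trans (leq_mul (leqnn _) (level_diff k S (arc E e).1 (arc E e).2 j)) _.
rewrite big_distrr /=; apply: leq_sum => i _.
by case: (i + j < k); rewrite ?muln0 ?mul1n.
Qed.

(** For a threshold set, the arcs of shift j that cross at (u, v) are given by the i with pi(u) <= i
    and i + j < pi(v), so the lower bound on their number is also an upper bound. *)
Lemma layered_cut_threshold a k E (pi : nat -> nat) : 0 < k ->
  layered_cut a k E (fun v i => pi v <= i) <=
  a 0 * (\sum_(e < size E) (pi (arc E e).2 - pi (arc E e).1)) +
  \sum_(e < size E) excess a k (pi (arc E e).2 - pi (arc E e).1).
Proof.
move=> k0; rewrite /layered_cut big_distrr -big_split /=; apply: leq_sum => e _.
have le j : \sum_(i < k) (i + j < k) * (a j * ((pi (arc E e).1 <= i) && ~~ (pi (arc E e).2 <= i + j)))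
    <= a j * (pi (arc E e).2 - pi (arc E e).1 - j).
  apply: leq_trans (leq_mul (leqnn _) (sum_threshold k _ _ _)).
  rewrite big_distrr /=; apply: leq_sum => i _; rewrite -ltnNge.
  by case: (i + j < k); rewrite ?mul1n.
rewrite exchange_big /= (sum_split0 _ k0) /=; apply: leq_add.
  by apply: leq_trans (le 0) _; rewrite subn0.
by apply: leq_sum => j _; apply: le.
Qed.

Lemma level_diff_mult k E S (e : 'I_(size E)) :
  level k S (arc E e).2 - level k S (arc E e).1 <= mult (layered_sol k E S) e.
Proof.
rewrite mult_layered; have := level_diff k S (arc E e).1 (arc E e).2 0.
rewrite subn0; move/leq_trans; apply; apply: leq_sum => i _.
by rewrite addn0 ltn_ord mul1n.
Qed.

Lemma sum_eq_pointwise (I : finType) (F G : I -> nat) :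
  (forall i, F i <= G i) -> \sum_i G i <= \sum_i F i -> forall i, F i = G i.
Proof.
move=> le ge i; apply/eqP; rewrite eqn_leq le leqNgt; apply/negP => lt.
suff : \sum_i F i < \sum_i G i by lia.
rewrite (bigD1 i) //= [X in _ < X](bigD1 i) //= -addSn; apply: leq_add => //.
exact: leq_sum.
Qed.

Lemma excess_bound b k mu : 0 < k -> (forall j, 0 < j -> b j <= 1) -> mu <= k ->
  excess b k mu <= k * k.
Proof.
move=> k0 b1 muk.
apply: (@leq_trans (\sum_(j < k) k)); last by rewrite sum_nat_const card_ord.
rewrite /excess big_mkcond; apply: leq_sum => j _; case: ltnP => // j0.
by have := b1 _ j0; nia.
Qed.

Section Layered.
Variables (E : seq (nat * nat)) (s t k : nat) (a : nat -> nat) (S : nat -> nat -> bool).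
Hypotheses (k0 : 0 < k) (st : s != t).
Hypothesis a0 : a 0 = (size E * k * k).+1.
Hypothesis a1 : forall j, 0 < j -> a j <= 1.
Hypothesis Ss : forall i, i < k -> S s i.
Hypothesis St : forall i, i < k -> ~~ S t i.
Hypothesis Smin : forall S' : nat -> nat -> bool,
  (forall i, i < k -> S' s i) -> (forall i, i < k -> ~~ S' t i) ->
  layered_cut a k E S <= layered_cut a k E S'.

Let X := layered_sol k E S.

Lemma layered_sol_main (D : seq {set 'I_(size E)}) :
  size D = k -> (forall Y, Y \in D -> is_min_st_cut s t Y) ->
  [/\ forall Y, Y \in X -> is_min_st_cut s t Y,
      \sum_e mult X e = \sum_e mult D e &
      \sum_e excess a k (mult X e) <= \sum_e excess a k (mult D e)].
Proof.
move=> sD minD.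
have cutD i : exists Sf : nat -> bool, i < k ->
    [/\ Sf s, ~~ Sf t & boundary E Sf \subset nth set0 D i].
  case: (ltnP i k) => ik; last by exists xpredT.
  have [|Sf h] := @cut_boundary E s t (nth set0 D i).
    by apply: (minD _ _).1; rewrite mem_nth ?sD.
  by exists Sf.
(* One vertex set is chosen for each member of [D]; together they form a layered set. *)
pose SD v i := proj1_sig (constructive_indefinite_description _ (cutD i)) v.
have SDP i : i < k -> [/\ SD s i, ~~ SD t i & boundary E (SD^~ i) \subset nth set0 D i].
  by rewrite /SD; case: constructive_indefinite_description.
pose pi := level k SD.
have pis : pi s = 0.
  by rewrite /pi /level big1 // => i _; have [-> _ _] := SDP i (ltn_ord i).
have pit : pi t = k.
  rewrite /pi /level -[RHS]card_ord -sum1_card; apply: eq_bigr => i _.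
  by have [_ -> _] := SDP i (ltn_ord i).
have leD (e : 'I_(size E)) : pi (arc E e).2 - pi (arc E e).1 <= mult D e.
  apply: leq_trans (level_diff_mult k SD e) _.
  rewrite /mult size_mkseq sD; apply: leq_sum => i _; rewrite nth_mkseq //.
  have [_ _ /subsetP sub] := SDP i (ltn_ord i).
  by case: (boolP (e \in boundary _ _)) => // /sub->.
have cost : a 0 * (\sum_e mult X e) +
    \sum_(e < size E) excess a k (level k S (arc E e).2 - level k S (arc E e).1) <=
    a 0 * (\sum_e mult D e) + \sum_e excess a k (mult D e).
  apply: leq_trans (layered_cut_geq a E S k0) _.
  apply: leq_trans (Smin (S' := fun v i => pi v <= i) _ _) _.
  - by move=> i; rewrite pis.
  - by move=> i; rewrite pit -ltnNge.
  apply: leq_trans (layered_cut_threshold a E pi k0) _.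
  apply: leq_add; first by apply: leq_mul => //; apply: leq_sum => e _; apply: leD.
  by apply: leq_sum => e _; apply: excess_le; apply: leD.
(* The total excess of a tuple is at most |E| k^2. So a 0 outweighs it, and costs compare
   lexicographically, first by total multiplicity. *)
have small : \sum_e excess a k (mult D e) < a 0.
  rewrite a0 ltnS -mulnA.
  apply: (@leq_trans (\sum_(e < size E) k * k)); last by rewrite sum_nat_const card_ord.
  by apply: leq_sum => e _; apply: excess_bound => //; rewrite -sD mult_le.
have sumle : \sum_e mult X e <= \sum_e mult D e by nia.
have [X0 [cX0 mX0]] := exists_min_cut E st.
pose lam := #|X0|.
have sumD : \sum_e mult D e = k * lam.
  rewrite sum_mult sD -[in RHS](card_ord k) -sum_nat_const; apply: eq_bigr => i _.
  have [cd md] : is_min_st_cut s t (nth set0 D i) by apply: minD; rewrite mem_nth ?sD.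
  by apply/eqP; rewrite eqn_leq /lam md // mX0.
have cutX i : i < k -> is_st_cut s t (nth set0 X i).
  by move=> ik; rewrite nth_mkseq //; apply: boundary_cut; [apply: Ss|apply: St].
have sumX : \sum_e mult X e = \sum_(i < k) #|nth set0 X i|.
  by rewrite sum_mult size_mkseq.
(* Each layer is a cut and so has at least lam arcs, while together they have at most k * lam. *)
have cardX (i : 'I_k) : lam = #|nth set0 X i|.
  apply: (@sum_eq_pointwise _ (fun _ => lam) (fun i : 'I_k => #|nth set0 X i|)).
    by move=> j; apply: mX0; apply: cutX.
  by rewrite -sumX sum_nat_const card_ord -sumD.
have sumXD : \sum_e mult X e = \sum_e mult D e.
  apply/eqP; rewrite eqn_leq sumle sumX sumD /= -[in leqLHS](card_ord k) -sum_nat_const.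
  by apply: leq_sum => i _; rewrite -cardX.
split=> //.
  move=> Y /(nthP set0)[i]; rewrite size_mkseq => ik <-; split; first exact: cutX.
  by move=> Z cZ; rewrite -(cardX (Ordinal ik)); apply: mX0.
pose p := level k S.
have ps : p s = 0 by rewrite /p /level big1 // => i _; rewrite Ss.
have pt : p t = k.
  rewrite /p /level -[RHS]card_ord -sum1_card; apply: eq_bigr => i _.
  by rewrite St.
(* A pointwise inequality between sums in the reverse order is an equality; the k threshold cuts of
   p bound the smaller side from below. *)
have tight (e : 'I_(size E)) : p (arc E e).2 - p (arc E e).1 = mult X e.
  apply: (@sum_eq_pointwise _ (fun e : 'I_(size E) => p (arc E e).2 - p (arc E e).1)).
    by move=> e'; apply: level_diff_mult.
  rewrite sumXD sumD -(card_ord k) -sum_nat_const.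
  apply: (@leq_trans (\sum_(i < k) #|boundary E (fun v => p v <= i)|)).
    apply: leq_sum => i _; apply: mX0; apply: boundary_cut; first by rewrite ps.
    by rewrite pt -ltnNge.
  rewrite (eq_bigr _ (fun i _ => card_set_sum _)).
  rewrite exchange_big /=; apply: leq_sum => e' _.
  have := sum_threshold k (p (arc E e').1) (p (arc E e').2) 0.
  rewrite subn0; apply: leq_trans; apply: leq_sum => i _.
  by rewrite inE addn0 -ltnNge.
under eq_bigr do rewrite -tight.
by rewrite -(leq_add2l (a 0 * \sum_e mult X e)) [in leqRHS]sumXD.
Qed.

(** Both diversities have this affine form. Since the total multiplicity is the same for X and for
    each competitor, the smallest excess gives the largest d. *)
Lemma layered_sol_optimal (d : diversity) (c1 c2 : nat) :
  0 < c1 ->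
  (forall C : seq {set 'I_(size E)}, size C = k ->
     d _ C + c1 * \sum_e excess a k (mult C e) = c2 * \sum_e mult C e) ->
  optimal_dmc d s t k X.
Proof.
move=> c10 dE; split; first by rewrite size_mkseq.
  have [X0 mX0] := exists_min_cut E st.
  (* Some tuple of minimum cuts is needed for the comparison; k copies of one will do. *)
  have [||//] := @layered_sol_main (nseq k X0); first by rewrite size_nseq.
  by move=> Y /nseqP[-> _].
move=> D sD mD; have [_ e1 e2] := layered_sol_main sD mD.
have := dE _ sD; have := dE X (size_mkseq _ _); rewrite e1.
by move: e2; rewrite -(leq_pmul2l c10); lia.
Qed.

End Layered.

(** Truncated subtraction encodes the case distinctions: 1 - j is 1 only at j = 0, and 1 - (j - 1)
    only at j <= 1. Both weights are m k^2 + 1 at 0; from j = 1 on, the first is constantly 1, and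
    the second is 1 at j = 1 and 0 afterwards. In this form the loop language can evaluate them. *)
Definition w_sum (m k j : nat) : nat := (1 - j) * m * k * k + 1.
Definition w_cov (m k j : nat) : nat := (1 - j) * m * k * k + (1 - (j - 1)).

Lemma excess_sum m k mu : mu <= k ->
  2 * excess (w_sum m k) k mu = mu * (mu - 1).
Proof.
move=> muk.
have -> : excess (w_sum m k) k mu = \sum_(0 <= j < k) (0 < j) * (mu - j).
  rewrite big_mkord /excess big_mkcond; apply: eq_bigr => j _.
  by case: ltnP => // j0; rewrite /w_sum; have -> : 1 - j = 0 by lia.
case: k muk => [|k] muk; first by rewrite big_nil; lia.
rewrite big_ltn // mul0n add0n.
have {muk} : mu.-1 <= k by lia.
have -> : \sum_(1 <= j < k.+1) (0 < j) * (mu - j) = \sum_(0 <= j < k) (mu.-1 - j).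
  rewrite big_add1 /=; apply: eq_bigr => j _; lia.
rewrite subn1; case: mu => [|mu] /=; first by rewrite big1.
elim: k mu => [|k IH] mu muk; first by rewrite big_nil; lia.
case: mu muk => [|mu] muk; first by rewrite big1.
rewrite big_nat_recl // subn0 mulnDr.
have -> : \sum_(0 <= i < k) (mu.+1 - i.+1) = \sum_(0 <= i < k) (mu - i) by [].
by rewrite IH //; nia.
Qed.

Lemma excess_cov m k mu : mu <= k -> excess (w_cov m k) k mu = mu - 1.
Proof.
move=> muk.
have -> : excess (w_cov m k) k mu = \sum_(0 <= j < k) (j == 1) * (mu - j).
  rewrite big_mkord /excess big_mkcond; apply: eq_bigr => j _.
  case: ltnP => [j0|]; last by rewrite leqn0 => /eqP->.
  rewrite /w_cov; have -> : 1 - j = 0 by lia.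
  by rewrite !mul0n add0n; case: eqP => [->|ne] //; have -> : 1 - (j - 1) = 0 by lia.
case: k muk => [|[|k]] muk; first by rewrite big_nil; lia.
  by rewrite big_nat1; lia.
rewrite big_ltn // big_ltn // mul0n add0n mul1n big_nat big1 ?addn0 // => j hj.
by have -> : j == 1 = false by lia.
Qed.

(** The constants 2 and k - 1 come from mu (k - mu) + mu (mu - 1) = (k - 1) mu. *)
Lemma layered_sum_optimal E s t k (S : nat -> nat -> bool) :
  0 < k -> s != t ->
  (forall i, i < k -> S s i) -> (forall i, i < k -> ~~ S t i) ->
  (forall S' : nat -> nat -> bool,
    (forall i, i < k -> S' s i) -> (forall i, i < k -> ~~ S' t i) ->
    layered_cut (w_sum (size E) k) k E S <= layered_cut (w_sum (size E) k) k E S') ->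
  optimal_dmc d_sum s t k (layered_sol k E S).
Proof.
move=> k0 st Ss St Smin.
apply: (@layered_sol_optimal E s t k (w_sum (size E) k) S k0 st _ _ Ss St Smin _ 2 (k - 1)) => //.
- by rewrite /w_sum; lia.
- by move=> j j0; rewrite /w_sum; have -> : 1 - j = 0 by lia.
move=> C sC; rewrite d_sumE sC !big_distrr -big_split /=; apply: eq_bigr => e _.
by have h : mult C e <= k; [rewrite -sC mult_le | rewrite excess_sum //; nia].
Qed.

(** Here the identity is [mu > 0] + (mu - 1) = mu, with truncated subtraction. *)
Lemma layered_cov_optimal E s t k (S : nat -> nat -> bool) :
  0 < k -> s != t ->
  (forall i, i < k -> S s i) -> (forall i, i < k -> ~~ S t i) ->
  (forall S' : nat -> nat -> bool,
    (forall i, i < k -> S' s i) -> (forall i, i < k -> ~~ S' t i) ->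
    layered_cut (w_cov (size E) k) k E S <= layered_cut (w_cov (size E) k) k E S') ->
  optimal_dmc d_cov s t k (layered_sol k E S).
Proof.
move=> k0 st Ss St Smin.
apply: (@layered_sol_optimal E s t k (w_cov (size E) k) S k0 st _ _ Ss St Smin _ 1 1) => //.
- by rewrite /w_cov; lia.
- move=> j j0; rewrite /w_cov; have -> : 1 - j = 0 by lia.
  by rewrite !mul0n add0n leq_subr.
move=> C sC; rewrite d_covE !mul1n -big_split /=; apply: eq_bigr => e _.
by have h : mult C e <= k; [rewrite -sC mult_le | rewrite excess_cov //; case: (mult C e) => //= n; lia].
Qed.

(** * Machine steps and a compiled loop language *)

Definition bounded (B : nat) (m : nat -> nat) : Prop := forall a, m a <= B.

(** Quantifying over every initial bound B makes the growth estimate compositional: the factors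
    [G ^ a] and [G ^ b] of consecutive runs multiply. *)
Definition steps (G : nat) (P : program) (st : state) (t : nat) (st' : state) : Prop :=
  run P t st = st' /\
  forall j B, j <= t -> 0 < B -> bounded B (mem st) ->
    bounded (B * G ^ j) (mem (run P j st)).

Lemma run_add P a b st : run P (a + b) st = run P b (run P a st).
Proof. by rewrite /run addnC iterD. Qed.

Lemma steps0 G P st : steps G P st 0 st.
Proof.
by split=> // j B; rewrite leqn0 => /eqP-> _ hB a; rewrite expn0 muln1; apply: hB.
Qed.

Lemma steps_trans G P st1 st2 st3 a b :
  0 < G -> steps G P st1 a st2 -> steps G P st2 b st3 -> steps G P st1 (a + b) st3.
Proof.
move=> G0 [r1 b1] [r2 b2]; split; first by rewrite run_add r1.
move=> j B jab B0 hB; have [ja|aj] := leqP j a; first exact: b1.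
rewrite -(subnKC (ltnW aj)) run_add r1 expnD mulnA.
apply: b2; [lia | by rewrite muln_gt0 B0 expn_gt0 G0 | rewrite -r1; exact: b1].
Qed.

Lemma steps1 G P st :
  (forall B, 0 < B -> bounded B (mem st) -> bounded (B * G) (mem (step P st))) ->
  steps G P st 1 (step P st).
Proof.
move=> h; split=> // -[|[|j]] B // _ B0 hB a; last by rewrite expn1; apply: h.
by rewrite expn0 muln1; apply: hB.
Qed.

Definition code_at (P : program) (l : nat) (cs : seq instr) : Prop :=
  forall i, i < size cs -> nth IHalt P (l + i) = nth IHalt cs i.

Lemma code_at_cat P l a b :
  code_at P l (a ++ b) -> code_at P l a /\ code_at P (l + size a) b.
Proof.
move=> h; split=> i hi.
  by rewrite h ?nth_cat ?hi // size_cat; lia.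
by rewrite -addnA h ?size_cat ?nth_cat; [rewrite ltnNge leq_addr /= addKn | lia].
Qed.

Lemma code_at_cons P l i cs :
  code_at P l (i :: cs) -> instr_at P l = i /\ code_at P l.+1 cs.
Proof.
move=> h; split; first by rewrite -[l]addn0 /instr_at h.
by move=> j hj; rewrite addSnnS h.
Qed.

Definition effect (i : instr) (m : nat -> nat) : nat -> nat :=
  match i with
  | IConst r c => upd m r c
  | IAdd r a b => upd m r (m a + m b)
  | ISub r a b => upd m r (m a - m b)
  | IMul r a b => upd m r (m a * m b)
  | IDiv r a b => upd m r (m a %/ m b)
  | ILoad r a => upd m r (m (m a))
  | IStore a r => upd m (m a) (m r)
  | _ => m
  end.

(** Jumps are rejected because [exec] models straight-line code. Constants and second factors must
    be at most G; sums need only G >= 2, and the other operations yield nothing above the values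
    already stored. *)
Definition growth_ok (G : nat) (i : instr) (m : nat -> nat) : bool :=
  match i with
  | IConst _ c => c <= G
  | IMul _ _ b => m b <= G
  | IJz _ _ | IJmp _ | IHalt => false
  | _ => true
  end.

Definition exec (cs : seq instr) (m : nat -> nat) : nat -> nat :=
  foldl (fun m i => effect i m) m cs.

Fixpoint exec_ok (G : nat) (cs : seq instr) (m : nat -> nat) : bool :=
  if cs is i :: cs' then growth_ok G i m && exec_ok G cs' (effect i m) else true.

Lemma exec_cat a b m : exec (a ++ b) m = exec b (exec a m).
Proof. by rewrite /exec foldl_cat. Qed.

Lemma exec_ok_cat G a b m :
  exec_ok G (a ++ b) m = exec_ok G a m && exec_ok G b (exec a m).
Proof. by elim: a m => //= i a IH m; rewrite IH andbA. Qed.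

Lemma bounded_upd B m r v : bounded B m -> v <= B -> bounded B (upd m r v).
Proof. by move=> h hv a; rewrite /upd; case: eqP. Qed.

Lemma bounded_le B B' m : B <= B' -> bounded B m -> bounded B' m.
Proof. by move=> le h a; apply: leq_trans (h a) le. Qed.

Lemma steps_effect G P l m i :
  1 < G -> instr_at P l = i -> growth_ok G i m ->
  steps G P (St l m) 1 (St l.+1 (effect i m)).
Proof.
move=> G1 hi ok.
have -> : St l.+1 (effect i m) = step P (St l m).
  by rewrite /step hi; case: i ok {hi}.
apply: steps1 => B B0 hB; rewrite /step hi.
have hB' : bounded (B * G) m by apply: bounded_le hB; apply: leq_pmulr; lia.
rewrite /= in hB.
case: i ok {hi} => [r c|r a b|r a b|r a b|r a b|r a|a r|r l'|l'|] //= ok;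
  apply: bounded_upd => //=.
- by apply: leq_trans ok _; apply: leq_pmull.
- by have := hB a; have := hB b; nia.
- by have := hB' a; lia.
- by apply: leq_mul.
- by apply: leq_trans (leq_div _ _) _.
Qed.

Lemma steps_exec G P l cs m :
  1 < G -> code_at P l cs -> exec_ok G cs m ->
  steps G P (St l m) (size cs) (St (l + size cs) (exec cs m)).
Proof.
move=> G1; elim: cs l m => [|i cs IH] l m /=; first by rewrite addn0 => *; apply: steps0.
move=> /code_at_cons[hi hcs] /andP[oki okcs].
rewrite -add1n addnA addn1; apply: (steps_trans (ltnW G1)); last exact: IH.
exact: steps_effect.
Qed.

Lemma steps_jmp G P l l' m :
  0 < G -> instr_at P l = IJmp l' -> steps G P (St l m) 1 (St l' m).
Proof.
move=> G0 hi; have -> : St l' m = step P (St l m) by rewrite /step hi.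
apply: steps1 => B B0 hB; rewrite /step hi /=.
by apply: bounded_le hB; apply: leq_pmulr.
Qed.

Lemma steps_jz G P l l' r m :
  0 < G -> instr_at P l = IJz r l' ->
  steps G P (St l m) 1 (St (if m r == 0 then l' else l.+1) m).
Proof.
move=> G0 hi.
have -> : St (if m r == 0 then l' else l.+1) m = step P (St l m).
  by rewrite /step hi; case: eqP.
apply: steps1 => B B0 hB; rewrite /step hi.
have hB' : bounded (B * G) m by apply: bounded_le hB; apply: leq_pmulr.
by case: eqP.
Qed.

(** * A loop language, its compiler and its running time *)

Inductive expr :=
| EC of nat
| EV of nat
| EAdd of expr & expr
| ESub of expr & expr
| EDiv of expr & expr
| EMul of expr & nat
| EGet of nat & expr.

Inductive com :=
| Skip
| Asg of nat & expr
| Put of nat & expr & expr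
| Seq of com & com
| If of expr & com & com
| Rep of nat & com.

Record store := Store { var : nat -> nat; arr : nat -> nat -> nat }.

Fixpoint ev (s : store) (e : expr) : nat :=
  match e with
  | EC c => c
  | EV x => var s x
  | EAdd a b => ev s a + ev s b
  | ESub a b => ev s a - ev s b
  | EDiv a b => ev s a %/ ev s b
  | EMul a x => ev s a * var s x
  | EGet a e => arr s a (ev s e)
  end.

Fixpoint den (c : com) (s : store) : store :=
  match c with
  | Skip => s
  | Asg x e => Store (upd (var s) x (ev s e)) (arr s)
  | Put a e1 e2 =>
      Store (var s) (fun b => if b == a then upd (arr s a) (ev s e1) (ev s e2) else arr s b)
  | Seq c1 c2 => den c2 (den c1 s)
  | If e c1 c2 => if ev s e == 0 then den c2 s else den c1 s
  | Rep x c => iter (var s x) (den c) s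
  end.

(* RAM layout: variables in registers 0..23 (0..5 are read-only), loop counters
   in 24..47, temporaries in 48..63, and cell y of array a at 64 + 8y + a. *)
Definition tmp (t : nat) : nat := 48 + t.
Definition ctr (d : nat) : nat := 24 + d.

Ltac tlia := unfold tmp, ctr in *; lia.

Definition caddr (r t a : nat) : seq instr :=
  [:: IConst (tmp t) 8; IMul r r (tmp t); IConst (tmp t) (64 + a); IAdd r r (tmp t)].

(** The temporaries form an expression stack: code at depth t leaves its value in [tmp t] and
    changes neither registers below [tmp t] nor array cells. *)
Fixpoint cexp (e : expr) (t : nat) : seq instr :=
  match e with
  | EC c => [:: IConst (tmp t) c]
  | EV x => [:: IConst (tmp t) 0; IAdd (tmp t) (tmp t) x]
  | EAdd a b => cexp a t ++ cexp b t.+1 ++ [:: IAdd (tmp t) (tmp t) (tmp t.+1)]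
  | ESub a b => cexp a t ++ cexp b t.+1 ++ [:: ISub (tmp t) (tmp t) (tmp t.+1)]
  | EDiv a b => cexp a t ++ cexp b t.+1 ++ [:: IDiv (tmp t) (tmp t) (tmp t.+1)]
  | EMul a x => cexp a t ++ [:: IMul (tmp t) (tmp t) x]
  | EGet a e => cexp e t ++ caddr (tmp t) t.+1 a ++ [:: ILoad (tmp t) (tmp t)]
  end.

Definition casg (x : nat) (e : expr) : seq instr :=
  cexp e 0 ++ [:: IConst x 0; IAdd x x (tmp 0)].

Definition cset (a : nat) (e1 e2 : expr) : seq instr :=
  cexp e1 0 ++ cexp e2 1 ++ caddr (tmp 0) 2 a ++ [:: IStore (tmp 0) (tmp 1)].

(* [l] is the absolute address of the code and [d] the loop depth, which
   selects the counter register. *)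
Fixpoint ccom (c : com) (d l : nat) : seq instr :=
  match c with
  | Skip => [::]
  | Asg x e => casg x e
  | Put a e1 e2 => cset a e1 e2
  | Seq c1 c2 => let k1 := ccom c1 d l in k1 ++ ccom c2 d (l + size k1)
  | If e c1 c2 =>
      let ke := cexp e 0 in
      let k1 := ccom c1 d (l + size ke).+1 in
      let l2 := (l + size ke + size k1).+2 in
      let k2 := ccom c2 d l2 in
      ke ++ IJz (tmp 0) l2 :: k1 ++ IJmp (l2 + size k2) :: k2
  | Rep x c =>
      let k := ccom c d.+1 l.+3 in
      [:: IConst (ctr d) 0; IAdd (ctr d) (ctr d) x;
          IJz (ctr d) (l + size k + 6)] ++
      k ++ [:: IConst (tmp 0) 1; ISub (ctr d) (ctr d) (tmp 0); IJmp l.+2]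
  end.

Fixpoint wfe (e : expr) (t : nat) : bool :=
  match e with
  | EC c => (c <= 100) && (t < 16)
  | EV x => (x < 24) && (t < 16)
  | EAdd a b | ESub a b | EDiv a b => wfe a t && wfe b t.+1
  | EMul a x => wfe a t && (x < 6)
  | EGet a e => [&& wfe e t, a < 8 & t.+1 < 16]
  end.

Fixpoint wfc (c : com) (d : nat) : bool :=
  match c with
  | Skip => true
  | Asg x e => (6 <= x < 24) && wfe e 0
  | Put a e1 e2 => [&& a < 8, wfe e1 0 & wfe e2 1]
  | Seq c1 c2 => wfc c1 d && wfc c2 d
  | If e c1 c2 => [&& wfe e 0, wfc c1 d & wfc c2 d]
  | Rep x c => [&& x < 6, d < 24 & wfc c d.+1]
  end.

Fixpoint time (L : nat) (c : com) : nat :=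
  match c with
  | Skip => 0
  | Asg x e => size (casg x e)
  | Put a e1 e2 => size (cset a e1 e2)
  | Seq c1 c2 => time L c1 + time L c2
  | If e c1 c2 => size (cexp e 0) + 2 + maxn (time L c1) (time L c2)
  | Rep x c => 3 + L * (time L c + 4)
  end.

(** The exponent in [time_le]: weights add up over sequences and branches, and every loop
    contributes one more factor. *)
Fixpoint weight (c : com) : nat :=
  match c with
  | Skip => 1
  | Asg x e => size (casg x e)
  | Put a e1 e2 => size (cset a e1 e2)
  | Seq c1 c2 => weight c1 + weight c2
  | If e c1 c2 => size (cexp e 0) + 2 + weight c1 + weight c2
  | Rep x c => (weight c).+1
  end.

Lemma weight_gt0 c : 0 < weight c.
Proof. by elim: c => //= *; rewrite ?size_cat /=; lia. Qed.

Lemma addX_leq X a b : 1 < X -> 0 < a -> 0 < b -> X ^ a + X ^ b <= X ^ (a + b).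
Proof.
move=> X1 a0 b0; rewrite expnD.
have := leq_pexp2l (ltnW X1) a0; have := leq_pexp2l (ltnW X1) b0.
by rewrite !expn1; nia.
Qed.

(** The base exceeds L by 6 to absorb the control instructions of a loop: 3 + L (T + 4) <= (L + 6) U
    whenever T <= U and U >= L + 6. *)
Lemma time_le L c : time L c <= (L + 6) ^ weight c.
Proof.
have X1 : 1 < L + 6 by lia.
have le_exp n : n <= (L + 6) ^ n by apply/ltnW/ltn_expl.
elim: c => [|x e|a e1 e2|c1 IH1 c2 IH2|e c1 IH1 c2 IH2|x c IH] //=.
- apply: leq_trans (leq_add IH1 IH2) _; apply: addX_leq => //; exact: weight_gt0.
- rewrite -[X in _ ^ X]addnA.
  apply: leq_trans (addX_leq X1 _ _); [|lia|have := weight_gt0 c1; lia].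
  apply: leq_add; first exact: le_exp.
  rewrite geq_max; apply/andP; split; [apply: leq_trans IH1 _|apply: leq_trans IH2 _];
  by apply: leq_pexp2l; lia.
- rewrite expnS.
  have := leq_pexp2l (ltnW X1) (weight_gt0 c).
  by rewrite expn1; nia.
Qed.

Definition sim (s : store) (m : nat -> nat) : Prop :=
  (forall x, x < 24 -> m x = var s x) /\
  (forall a y, a < 8 -> m (64 + 8 * y + a) = arr s a y).

Lemma sim_frame s m m' :
  sim s m -> (forall r, (r < 24) || (64 <= r) -> m' r = m r) -> sim s m'.
Proof.
move=> [hv ha] h; split=> [x hx|a y ha8]; first by rewrite h ?hx ?hv.
by rewrite h ?ha //; lia.
Qed.

Lemma caddr_ok G r t a m :
  100 <= G -> a < 8 -> r < tmp t ->
  let m' := exec (caddr r t a) m in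
  [/\ exec_ok G (caddr r t a) m, m' r = 64 + 8 * m r + a &
      forall x, x != r -> x != tmp t -> m' x = m x].
Proof.
move=> G1 a8 rt; rewrite /caddr.
have rt' : r == tmp t = false by lia.
rewrite /= /upd !eqxx rt'; split; first by lia.
  by lia.
by move=> x /negbTE-> /negbTE->.
Qed.

Lemma wfe_tmp e t : wfe e t -> tmp t < 64.
Proof.
elim: e t => [c|x|a IHa b _|a IHa b _|a IHa b _|a IHa x|a e IH] t /=;
  try by move=> /andP[/IHa].
- by move=> /andP[_]; tlia.
- by move=> /andP[_]; tlia.
- by move=> /and3P[/IH].
Qed.

Lemma cexp_ok G s e t m :
  100 <= G -> (forall x, x < 6 -> var s x <= G) ->
  sim s m -> wfe e t ->
  let m' := exec (cexp e t) m in
  [/\ exec_ok G (cexp e t) m, m' (tmp t) = ev s e &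
      forall r, (r < tmp t) || (64 <= r) -> m' r = m r].
Proof.
move=> G1 hro.
(* The three binary operations share one argument; i is the final instruction and v its value. *)
have bin (a b : expr) t0 m0 (i : instr) (v : nat) :
   (let m' := exec (cexp a t0) m0 in
    [/\ exec_ok G (cexp a t0) m0, m' (tmp t0) = ev s a &
      forall r, (r < tmp t0) || (64 <= r) -> m' r = m0 r]) ->
   (forall m0, sim s m0 -> let m' := exec (cexp b t0.+1) m0 in
    [/\ exec_ok G (cexp b t0.+1) m0, m' (tmp t0.+1) = ev s b &
      forall r, (r < tmp t0.+1) || (64 <= r) -> m' r = m0 r]) ->
   sim s m0 -> tmp t0 < 64 ->
   (forall m1, m1 (tmp t0) = ev s a -> m1 (tmp t0.+1) = ev s b ->
      growth_ok G i m1 /\ effect i m1 = upd m1 (tmp t0) v) ->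
   let m' := exec (cexp a t0 ++ cexp b t0.+1 ++ [:: i]) m0 in
   [/\ exec_ok G (cexp a t0 ++ cexp b t0.+1 ++ [:: i]) m0, m' (tmp t0) = v &
      forall r, (r < tmp t0) || (64 <= r) -> m' r = m0 r].
  move=> /= [oka va fa] hb sm lt hi.
  have sm1 : sim s (exec (cexp a t0) m0).
    by apply: sim_frame sm _ => r hr; apply: fa; tlia.
  have [okb vb fb] := hb _ sm1.
  have ha : exec (cexp b t0.+1) (exec (cexp a t0) m0) (tmp t0) = ev s a.
    by rewrite fb ?va //; tlia.
  have [gi ei] := hi _ ha vb.
  rewrite !exec_ok_cat !exec_cat oka okb /= gi ei; split=> //.
    by rewrite /upd eqxx.
  move=> r hr; rewrite /upd ifN; last by lia.
  by rewrite fb ?fa //; tlia.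
elim: e t m => [c|x|a IHa b IHb|a IHa b IHb|a IHa b IHb|a IHa x|a e IH] t m sm /=.
- move=> /andP[c100 t16]; split; first by lia.
    by rewrite /upd eqxx.
  by move=> r hr; rewrite /upd ifN //; tlia.
- move=> /andP[x24 t16]; split=> //.
    rewrite /upd !eqxx ifN; last by tlia.
    by rewrite add0n; apply: sm.1.
  by move=> r hr; rewrite /upd !ifN //; tlia.
- move=> /andP[wa wb]; apply: bin => //; [exact: IHa|by move=> m0 h; exact: IHb| |].
    exact: wfe_tmp wa.
  by move=> m1 /= -> ->.
- move=> /andP[wa wb]; apply: bin => //; [exact: IHa|by move=> m0 h; exact: IHb| |].
    exact: wfe_tmp wa.
  by move=> m1 /= -> ->.
- move=> /andP[wa wb]; apply: bin => //; [exact: IHa|by move=> m0 h; exact: IHb| |].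
    exact: wfe_tmp wa.
  by move=> m1 /= -> ->.
- move=> /andP[wa x6]; have [oka va fa] := IHa t m sm wa.
  have hx : exec (cexp a t) m x = var s x.
    by rewrite fa ?sm.1 //; tlia.
  rewrite exec_ok_cat exec_cat oka /= hx va andbT; split; first exact: hro.
    by rewrite /upd eqxx.
  move=> r hr; rewrite /upd ifN ?fa //.
  by have := wfe_tmp wa; lia.
- move=> /and3P[we a8 t16]; have [oke ve fe] := IH t m sm we.
  have tt : tmp t < tmp t.+1 by [].
  have [okc vc fc] := caddr_ok (exec (cexp e t) m) G1 a8 tt.
  rewrite -[cexp e t ++ _]/(cexp e t ++ caddr (tmp t) t.+1 a ++ [:: ILoad (tmp t) (tmp t)]).
  rewrite !exec_ok_cat !exec_cat oke okc; split=> //;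
  set m1 := exec (caddr _ _ _) _ in vc fc *; rewrite /=.
    rewrite /upd eqxx vc ve fc; [|by tlia|by tlia].
    by rewrite fe ?sm.2 //; lia.
  move=> r hr; rewrite /upd ifN ?fc ?fe //; tlia.
Qed.

Lemma den_ro c d s x : wfc c d -> x < 6 -> var (den c s) x = var s x.
Proof.
move=> + x6; elim: c d s => [|y e|a e1 e2|c1 IH1 c2 IH2|e c1 IH1 c2 IH2|y c IH] d s //=.
- by move=> /andP[/andP[y6 _] _]; rewrite /upd ifN //; lia.
- by move=> /andP[w1 w2]; rewrite (IH2 d) // (IH1 d).
- by move=> /and3P[_ w1 w2]; case: eqP => _; [rewrite (IH2 d)|rewrite (IH1 d)].
- move=> /and3P[_ _ w]; move: (var s y) => n.
  by elim: n => //= n IHn; rewrite (IH d.+1).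
Qed.

Lemma sim_var s m m' x v :
  sim s m -> x < 24 -> (forall r, (r < 24) || (64 <= r) -> m' r = upd m x v r) ->
  sim (Store (upd (var s) x v) (arr s)) m'.
Proof.
move=> [hv ha] x24 h; split=> [y hy|a y ha8] /=; first by rewrite h /upd ?hy ?hv.
by rewrite h /upd ?ifN ?ha //; lia.
Qed.

(** The last conclusion protects the counters of the enclosing loops, without which the induction
    would fail at [Rep]. Read-only variables are at most L throughout, so L bounds the rounds of
    every loop. *)
Lemma ccom_ok G P L c d l s m :
  100 <= G -> L <= G -> d <= 24 ->
  code_at P l (ccom c d l) -> wfc c d -> sim s m ->
  (forall x, x < 6 -> var s x <= L) ->
  exists t m', [/\ steps G P (St l m) t (St (l + size (ccom c d l)) m'),
    t <= time L c, sim (den c s) m' &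
    forall r, 24 <= r < ctr d -> m' r = m r].
Proof.
move=> G1 LG; have G2 : 1 < G by lia. have G0 : 0 < G by lia.
elim: c d l s m => [|x e|a e1 e2|c1 IH1 c2 IH2|e c1 IH1 c2 IH2|x c IH] d l s m;
  move=> d24 code wf sm ro;
  have roG x' (hx' : x' < 6) : var s x' <= G by exact: leq_trans (ro _ hx') LG.
- by exists 0, m; rewrite addn0; split=> //; apply: steps0.
- move: wf => /= /andP[/andP[x6 x24] we].
  have [oke ve fe] := cexp_ok G1 roG sm we.
  have ok : exec_ok G (casg x e) m by rewrite exec_ok_cat oke.
  exists (size (casg x e)), (exec (casg x e) m); split=> //; first exact: steps_exec.
    apply: (sim_var sm) => // r hr.
    rewrite exec_cat /= /upd eqxx; case: (eqVneq r x) => [_|nx].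
      by rewrite ifN ?ve //; tlia.
    by rewrite fe //; tlia.
  move=> r hr; rewrite exec_cat /= /upd !ifN ?fe //; tlia.
- move: wf => /= /and3P[a8 w1 w2].
  have [ok1 v1 f1] := cexp_ok G1 roG sm w1.
  have sm1 : sim s (exec (cexp e1 0) m).
    by apply: sim_frame sm _ => r hr; apply: f1; tlia.
  have [ok2 v2 f2] := cexp_ok G1 roG sm1 w2.
  have tt : tmp 0 < tmp 2 by [].
  have [ok3 v3 f3] := caddr_ok (exec (cexp e2 1) (exec (cexp e1 0) m)) G1 a8 tt.
  have ok : exec_ok G (cset a e1 e2) m.
    by rewrite !exec_ok_cat ok1 ok2 ok3.
  have e3 : exec (cset a e1 e2) m =
      upd (exec (caddr (tmp 0) 2 a) (exec (cexp e2 1) (exec (cexp e1 0) m)))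
        (64 + 8 * ev s e1 + a) (ev s e2).
    set m3 := exec (caddr _ _ _) _ in v3 f3 *.
    have -> : exec (cset a e1 e2) m = upd m3 (m3 (tmp 0)) (m3 (tmp 1)).
      by rewrite /cset !exec_cat.
    by rewrite v3 f2 // v1 f3 // v2.
  exists (size (cset a e1 e2)), (exec (cset a e1 e2) m); split=> //; first exact: steps_exec.
    rewrite e3; split=> [x hx|b y b8]; rewrite /upd.
      by rewrite ifN ?f3 ?f2 ?f1 ?sm.1 //; tlia.
    have -> : arr (den (Put a e1 e2) s) b y =
      (if b == a then upd (arr s a) (ev s e1) (ev s e2) else arr s b) y by [].
    rewrite /upd.
    case: eqP => [e|ne].
      have -> : b = a by lia.
      have -> : y = ev s e1 by lia.
      by rewrite !eqxx.
    rewrite f3 ?f2 ?f1 ?sm.2 //; try by tlia.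
    case: eqP => // ba; case: eqP => // ye; first by case: ne; lia.
    by rewrite ba.
  by move=> r hr; rewrite e3 /upd ifN ?f3 ?f2 ?f1 //; tlia.
- move: wf code => /= /andP[w1 w2] /code_at_cat[code1 code2].
  have [t1 [m1 [st1 le1 sm1 fr1]]] := IH1 d l s m d24 code1 w1 sm ro.
  have ro1 x : x < 6 -> var (den c1 s) x <= L by move=> hx; rewrite (den_ro _ w1) ?ro.
  have [t2 [m2 [st2 le2 sm2 fr2]]] := IH2 d _ _ m1 d24 code2 w2 sm1 ro1.
  exists (t1 + t2), m2; split=> //.
  + rewrite size_cat addnA; exact: steps_trans st1 st2.
  + exact: leq_add.
  + by move=> r hr; rewrite fr2 ?fr1.
- move: wf code => /= /and3P[we w1 w2] /code_at_cat[codee] /code_at_cons[ijz].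
  move=> /code_at_cat[code1] /code_at_cons[ijmp code2].
  have [oke ve fe] := cexp_ok G1 roG sm we.
  set me := exec (cexp e 0) m in ve fe.
  have sme : sim s me.
    by apply: sim_frame sm _ => r hr; apply: fe; tlia.
  have ste := steps_exec G2 codee oke.
  have stz := steps_jz me G0 ijz; rewrite ve in stz.
  rewrite size_cat /= size_cat /=.
  case: eqP stz => _ stz.
    have e2 : (l + size (cexp e 0)).+1 + size (ccom c1 d (l + size (cexp e 0)).+1) =
      (l + size (cexp e 0) + size (ccom c1 d (l + size (cexp e 0)).+1)).+1 by lia.
    rewrite e2 in code2.
    have [t2 [m2 [st2 le2 sm2 fr2]]] := IH2 d _ _ me d24 code2 w2 sme ro.
    exists (size (cexp e 0) + (1 + t2)), m2; split=> //.
    + apply: steps_trans ste _ => //; apply: steps_trans stz _ => //.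
      set q2 := (X in steps _ _ _ _ (St X _)) in st2; set q := (X in steps _ _ _ _ (St X _)).
      by have -> : q = q2 by rewrite /q /q2; lia.
    + by lia.
    + by move=> r hr; rewrite fr2 // fe //; tlia.
  have [t1 [m1 [st1 le1 sm1 fr1]]] := IH1 d _ _ me d24 code1 w1 sme ro.
  have stj := steps_jmp m1 G0 ijmp.
  exists (size (cexp e 0) + (1 + (t1 + 1))), m1; split=> //.
  + apply: steps_trans ste _ => //; apply: steps_trans stz _ => //.
    apply: steps_trans st1 _ => //.
    set q := (X in steps _ _ _ _ (St X _)) in stj; set q' := (X in steps _ _ _ _ (St X _)).
    by have -> : q' = q by rewrite /q /q'; lia.
  + by lia.
  + by move=> r hr; rewrite fr1 // fe //; tlia.
- move: wf code => /= /and3P[x6 d24' w].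
  set k := ccom c d.+1 l.+3 => /code_at_cons[i0] /code_at_cons[i1] /code_at_cons[i2].
  move=> /code_at_cat[codek] /code_at_cons[i3] /code_at_cons[i4] /code_at_cons[i5 _].
  set lend := l + size k + 6 in i2.
  have lendE : l + (size (k ++ [:: IConst (tmp 0) 1; ISub (ctr d) (ctr d) (tmp 0);
     IJmp l.+2])).+3 = lend.
    by rewrite /lend size_cat /=; lia.
  rewrite lendE.
  (* Induction on the counter, over arbitrary stores: the first round is split off, as in the
     execution. *)
  have loop n : forall s m, n <= L -> sim s m -> (forall x, x < 6 -> var s x <= L) ->
    m (ctr d) = n -> exists t m', [/\ steps G P (St l.+2 m) t (St lend m'),
      t <= 1 + n * (time L c + 4), sim (iter n (den c) s) m' &
      forall r, 24 <= r < ctr d -> m' r = m r].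
    elim: n => [|n IHn] s0 m0 nL sm0 ro0 hm0.
      exists 1, m0; split=> //; have := steps_jz m0 G0 i2; by rewrite hm0.
    have stz := steps_jz m0 G0 i2; rewrite hm0 /= in stz.
    have [t1 [m1 [st1 le1 sm1 fr1]]] := IH d.+1 _ _ m0 d24' codek w sm0 ro0.
    have hc : m1 (ctr d) = n.+1 by rewrite fr1 //; tlia.
    have g3 : growth_ok G (IConst (tmp 0) 1) m1 by rewrite /=; lia.
    have st3 := steps_effect G2 i3 g3.
    set m2 := effect _ _ in st3.
    have g4 : growth_ok G (ISub (ctr d) (ctr d) (tmp 0)) m2 by [].
    have st4 := steps_effect G2 i4 g4.
    set m3 := effect _ _ in st4.
    have st5 := steps_jmp m3 G0 i5.
    have hc3 : m3 (ctr d) = n.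
      rewrite /m3 /= /upd eqxx /m2 /= /upd eqxx ifN ?hc; first by lia.
      by tlia.
    have fr3 r : r != ctr d -> r != tmp 0 -> m3 r = m1 r.
      by rewrite /m3 /m2 /= /upd => /negbTE-> /negbTE->.
    have sm3 : sim (den c s0) m3.
      by apply: sim_frame sm1 _ => r hr; apply: fr3; tlia.
    have ro3 y : y < 6 -> var (den c s0) y <= L.
      by move=> hy; rewrite (den_ro _ w) ?ro0.
    have [t4 [m4 [st6 le4 sm4 fr4]]] := IHn (den c s0) m3 (ltnW nL) sm3 ro3 hc3.
    exists (1 + (t1 + (1 + (1 + (1 + t4))))), m4; split=> //.
    + apply: steps_trans stz _ => //; apply: steps_trans st1 _ => //.
      apply: steps_trans st3 _ => //; apply: steps_trans st4 _ => //.
      exact: steps_trans st5 st6.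
    + by nia.
    + by rewrite iterSr.
    + move=> r hr; rewrite fr4 // fr3 ?fr1 //; tlia.
  have g0 : growth_ok G (IConst (ctr d) 0) m by [].
  have st0 := steps_effect G2 i0 g0.
  set m1 := effect _ _ in st0.
  have g1 : growth_ok G (IAdd (ctr d) (ctr d) x) m1 by [].
  have st1 := steps_effect G2 i1 g1.
  set m2 := effect _ _ in st1.
  have hc : m2 (ctr d) = var s x.
    rewrite /m2 /m1 /= /upd !eqxx ifN ?sm.1 //; tlia.
  have fr r : r != ctr d -> m2 r = m r.
    by rewrite /m2 /m1 /= /upd => /negbTE->.
  have sm2 : sim s m2.
    by apply: sim_frame sm _ => r hr; apply: fr; tlia.
  have [t3 [m3 [st3 le3 sm3 fr3]]] := loop _ s m2 (ro _ x6) sm2 ro hc.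
  exists (1 + (1 + t3)), m3; split=> //.
  + apply: steps_trans st0 _ => //; exact: steps_trans st1 st3.
  + by have := ro _ x6; nia.
  + by move=> r hr; rewrite fr3 // fr //; lia.
Qed.

(** * Relocating input and output *)

(* Register 11 counts the cells; 10 and 13 hold source address and stride, 2 and 1
   target address and stride, and 14 holds 1. *)
Definition copy_loop (lp : nat) : seq instr :=
  [:: IJz 11 (lp + 7); ILoad 12 10; IStore 2 12; IAdd 2 2 1; IAdd 10 10 13;
      ISub 11 11 14; IJmp lp].

(** The copy runs forward, so source and target may overlap as long as no cell is written before it
    is read. *)
Lemma copy_loop_ok G P lp m p a c ds ss :
  1 < G -> code_at P lp (copy_loop lp) ->
  m 2 = p -> m 10 = a -> m 11 = c -> m 1 = ds -> m 13 = ss -> m 14 = 1 ->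
  64 <= p -> 64 <= a -> 0 < ds ->
  (forall i j, i < j -> j < c -> p + ds * i != a + ss * j) ->
  exists m', [/\ steps G P (St lp m) (1 + 7 * c) (St (lp + 7) m'),
    (forall i, i < c -> m' (p + ds * i) = m (a + ss * i)),
    (forall r, 64 <= r -> (forall i, i < c -> r != p + ds * i) -> m' r = m r) &
    (forall r, r < 64 -> r \notin [:: 2; 10; 11; 12] -> m' r = m r)].
Proof.
move=> G1 code; have G0 : 0 < G by lia.
elim: c p a m => [|c IH] p a m h2 h10 h11 h1 h13 h14 p64 a64 ds0 sep.
  exists m; split=> //; have [i0 _] := code_at_cons code.
  by have := steps_jz m G0 i0; rewrite h11.
have [i0 code1] := code_at_cons code.
have st0 := steps_jz m G0 i0; rewrite h11 /= in st0.
pose body := [:: ILoad 12 10; IStore 2 12; IAdd 2 2 1; IAdd 10 10 13; ISub 11 11 14].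
have [codeb codej] : code_at P lp.+1 body /\ code_at P (lp.+1 + 5) [:: IJmp lp].
  exact: (@code_at_cat P lp.+1 body [:: IJmp lp]).
have st1 := @steps_exec G P lp.+1 body m G1 codeb isT.
have [ij _] := code_at_cons codej.
have e1 : exec body m =
    upd (upd (upd (upd (upd m 12 (m a)) p (m a)) 2 (p + ds)) 10 (a + ss)) 11 c.
  rewrite /exec /= h10 /upd /= h2.
  have n11 : 11 == p = false by lia. have n10 : 10 == p = false by lia.
  have n2 : 2 == p = false by lia. have n1 : 1 == p = false by lia.
  have n13 : 13 == p = false by lia. have n14 : 14 == p = false by lia.
  by rewrite n11 n10 n2 n1 n13 n14 h1 h10 h11 h13 h14 subn1.
set m1 := exec body m in st1 e1.
have stj := steps_jmp m1 G0 ij.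
have lo r : r < 64 -> r \notin [:: 2; 10; 11; 12] -> m1 r = m r.
  move=> r64; rewrite !inE e1 /upd.
  have -> : r == p = false by lia.
  by case: (r == 2) => //; case: (r == 10) => //; case: (r == 11) => //; case: (r == 12).
have hi r : 64 <= r -> r != p -> m1 r = m r.
  by move=> r64 rp; rewrite e1 /upd !ifN //; lia.
have m1p : m1 p = m a.
  by rewrite e1 /upd eqxx !ifN //; lia.
have [||||||||||m' [st' v' f' l']] := IH (p + ds) (a + ss) m1.
- by rewrite e1.
- by rewrite e1.
- by rewrite e1.
- by rewrite lo.
- by rewrite lo.
- by rewrite lo.
- by lia.
- by lia.
- by [].
- move=> i j ij' jc; have := sep i.+1 j.+1; rewrite !mulnS; lia.
exists m'; split.
- have -> : 1 + 7 * c.+1 = 1 + (5 + (1 + (1 + 7 * c))) by lia.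
  apply: (steps_trans G0 st0); apply: (steps_trans G0 st1).
  exact: steps_trans stj st'.
- case=> [|i] ic.
    rewrite !muln0 !addn0 f' ?m1p //; move=> i _; nia.
  rewrite !mulnS !addnA v' //; apply: hi; first by lia.
  by have := sep 0 i.+1 isT ic; rewrite muln0 addn0 mulnS addnA eq_sym.
- move=> r r64 hr; rewrite f' ?hi //.
    by have := hr 0 isT; rewrite muln0 addn0.
  by move=> i ic; have := hr i.+1 ic; rewrite mulnS addnA.
- by move=> r r64 hr; rewrite l' ?lo.
Qed.

(** Unrolled, since each register must be named directly and only registers 1 and 2, freed by the
    packing, are available as stride and pointer. *)
Definition save_code (a c : nat) : seq instr :=
  flatten [seq [:: IStore 2 r; IAdd 2 2 1] | r <- iota a c].

Lemma save_code_ok G a c m p :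
  m 2 = p -> m 1 = 8 -> 64 <= p -> 5 <= a -> a + c <= 64 ->
  let m' := exec (save_code a c) m in
  [/\ exec_ok G (save_code a c) m, m' 2 = p + 8 * c,
      (forall i, i < c -> m' (p + 8 * i) = m (a + i)) &
      (forall r, r != 2 -> (r < p) || (p + 8 * c <= r) -> m' r = m r)].
Proof.
elim: c a m p => [|c IH] a m p h2 h1 p64 a5 ac.
  by split=> //; rewrite muln0 addn0.
rewrite /save_code /= -/(save_code _ _).
set m1 := upd _ 2 _.
have e1 : m1 = upd (upd m p (m a)) 2 (p + 8).
  rewrite /m1 /upd /= h2.
  have -> : 2 == p = false by lia.
  have -> : 1 == p = false by lia.
  by rewrite h1.
have [||||| ok v2 v f] := IH a.+1 m1 (p + 8); try by lia.
- by rewrite e1.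
- by rewrite e1 /upd /= ifN //; lia.
have fr r : r != 2 -> r != p -> m1 r = m r.
  by rewrite e1 /upd => /negbTE-> /negbTE->.
split=> //.
- by rewrite v2; lia.
- case=> [|i] ic.
    rewrite muln0 !addn0 f; [|lia|lia].
    by rewrite e1 /upd eqxx ifN //; lia.
  have -> : p + 8 * i.+1 = p + 8 + 8 * i by lia.
  by rewrite v ?fr ?addSnnS //; lia.
- by move=> r r2 hr; rewrite f ?fr //; lia.
Qed.

(* The input fills an initial segment of the memory of unknown length, so at first only
   the registers 0..4 holding n, s, t, k, |E| are at hand.  Packing k, s, t into
   k n^2 + s n + t frees two of them, enough to move the other registers away. *)
Definition prologue_pack : seq instr :=
  [:: IMul 1 1 0; IAdd 1 1 2; IMul 2 0 0; IMul 3 3 2; IAdd 3 3 1;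
      IConst 1 16; IMul 2 4 1; IConst 1 64; IAdd 2 2 1; IConst 1 8].
Definition prologue_unpack : seq instr :=
  [:: IMul 5 0 0; IDiv 6 3 5; IMul 7 6 5; ISub 7 3 7; IDiv 8 7 0; IMul 9 8 0;
      ISub 9 7 9; IConst 10 64; IAdd 11 4 4; IConst 13 1; IConst 14 1].
Definition prologue_vars : seq instr :=
  [:: IAdd 5 0 6; IAdd 5 5 4; IAdd 5 5 13; IConst 1 0; IAdd 1 1 6; IConst 2 0;
      IAdd 2 2 4; IConst 3 0; IAdd 3 3 8; IConst 4 0; IAdd 4 4 9].
Definition prologue_straight : seq instr :=
  prologue_pack ++ save_code 5 59 ++ prologue_unpack.
(* 139 is the length of [prologue_straight], where the loop starts. *)
Definition prologue : seq instr :=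
  prologue_straight ++ copy_loop 139 ++ prologue_vars.

Definition input_ok (n s t k : nat) (E : seq (nat * nat)) (st : store) : Prop :=
  [/\ [/\ var st 0 = n, var st 1 = k & var st 2 = size E],
      [/\ var st 3 = s, var st 4 = t & var st 5 = (n + size E + k).+1] &
      forall e, e < size E ->
        arr st 0 (2 * size E + 2 * e) = (arc E e).1 /\
        arr st 0 (2 * size E + 2 * e + 1) = (arc E e).2].

Lemma nth_flatten_pairs (E : seq (nat * nat)) e : e < size E ->
  nth 0 (flatten [seq [:: x.1; x.2] | x <- E]) (2 * e) = (arc E e).1 /\
  nth 0 (flatten [seq [:: x.1; x.2] | x <- E]) (2 * e + 1) = (arc E e).2.
Proof.
elim: E e => // x E IH [|e] // he; have [h1 h2] := IH e he.
have -> : 2 * e.+1 = (2 * e).+2 by lia.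
by rewrite addSn addSn; split.
Qed.

Definition store_of (m : nat -> nat) : store :=
  Store m (fun a y => m (64 + 8 * y + a)).

(** The arcs go to cell 2|E| of array 0, that is to address 16|E| + 64, beyond the 5 + 2|E| cells of
    the input. The loop moves 2|E| cells from address 64 on, more than remain there; the surplus
    falls behind the cells described by [input_ok]. *)
Lemma prologue_ok G P n s t k (E : seq (nat * nat)) :
  valid_instance n s t k E -> 1000 <= G -> n * n <= G ->
  code_at P 0 prologue ->
  exists m' T, [/\ steps G P (init_state (encode n s t k E)) T (St (size prologue) m'),
    T <= 200 + 14 * size E & input_ok n s t k E (store_of m')].
Proof.
move=> [sn tn _ k0 _] G1 nG.
set M := size E.
have G2 : 1 < G by lia. have G0 : 0 < G by lia.
rewrite /prologue => /code_at_cat[codes] /code_at_cat[codel codev].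
pose m0 := fun a => nth 0 (encode n s t k E) a.
have m0E x : m0 (5 + x) = nth 0 (flatten [seq [:: x.1; x.2] | x <- E]) x by [].
pose m1 := exec prologue_pack m0.
have nG' : n <= G by nia.
have ok1 : exec_ok G prologue_pack m0.
  by rewrite /= /upd /= /m0 /=; apply/and5P; split=> //; nia.
have m1_0 : m1 0 = n by [].
have m1_1 : m1 1 = 8 by [].
have m1_2 : m1 2 = M * 16 + 64 by [].
have m1_3 : m1 3 = k * (n * n) + (s * n + t) by [].
have m1_4 : m1 4 = M by [].
have m1_f r : 5 <= r -> m1 r = m0 r.
  by case: r => [|[|[|[|[|r]]]]].
have [|||ok2 v2 v f] := @save_code_ok G 5 59 m1 _ m1_2 m1_1; try by lia.
have [m2 em2] : exists m2, exec (save_code 5 59) m1 = m2 by exists (exec (save_code 5 59) m1).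
rewrite em2 in v2 v f.
have lo r : r < 64 -> r != 2 -> m2 r = m1 r by move=> r64 r2; apply: f => //; lia.
pose m3 := exec prologue_unpack m2.
(* From s, t < n follows s n + t < n^2, so dividing by n^2 and then by n recovers k, s and t. *)
have dk : (k * (n * n) + (s * n + t)) %/ (n * n) = k.
  by rewrite divnMDl ?divn_small ?addn0 //; nia.
have ds : (k * (n * n) + (s * n + t) - k * (n * n)) = s * n + t by lia.
have dn : (s * n + t) %/ n = s by rewrite divnMDl ?divn_small ?addn0 //; lia.
have e3 : forall r, m3 r = nth (m2 r)
   [:: n; 8; M * 16 + 64 + 8 * 59; k * (n * n) + (s * n + t); M; n * n; k;
       s * n + t; s; t; 64; M + M; m2 12; 1; 1] r.
  have l0 := lo 0 isT isT; have l1 := lo 1 isT isT; have l3 := lo 3 isT isT.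
  have l4 := lo 4 isT isT.
  rewrite m1_0 in l0; rewrite m1_1 in l1; rewrite m1_3 in l3; rewrite m1_4 in l4.
  case=> [|[|[|[|[|[|[|[|[|[|[|[|[|[|[|r]]]]]]]]]]]]]]]; rewrite /m3 /exec /= /upd /=;
    rewrite ?l0 ?l1 ?v2 ?l3 ?l4 ?dk ?ds ?dn //; try lia.
  by rewrite nth_nil.
have ok3 : exec_ok G prologue_unpack m2.
  have l0 := lo 0 isT isT; rewrite m1_0 in l0.
  by rewrite /= /upd /= l0 /= nG nG' /=; lia.
have oks : exec_ok G prologue_straight m0.
  by rewrite /prologue_straight exec_ok_cat ok1 -/m1 exec_ok_cat ok2 em2.
have sts := steps_exec G2 codes oks.
have es : exec prologue_straight m0 = m3 by rewrite /prologue_straight exec_cat -/m1 exec_cat em2.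
have sz : size prologue_straight = 139 by [].
rewrite es sz !add0n in sts codel codev.
have hi r : 64 <= r -> m3 r = m2 r.
  by move=> r64; rewrite e3 nth_default //= (leq_trans _ r64).
have [||||||||||m4 [st4 v4 f4 l4]] :=
  copy_loop_ok (p := M * 16 + 64 + 8 * 59) (a := 64) (c := M + M) (ds := 8) (ss := 1)
    (m := m3) G2 codel; try by rewrite e3.
- by lia.
- by [].
- by [].
- by move=> i j; lia.
have stv := @steps_exec G P _ prologue_vars m4 G2 codev.
have okv : exec_ok G prologue_vars m4 by rewrite /=; clear -G1; lia.
have {stv} stv := stv okv.
pose m5 := exec prologue_vars m4.
have hi5 r : 64 <= r -> m5 r = m4 r.
  move=> r64; have -> : r = 6 + (r - 6) by clear -r64; lia.
  by [].
have lo4 r : r < 64 -> r \notin [:: 2; 10; 11; 12] -> m4 r = nth (m2 r)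
   [:: n; 8; M * 16 + 64 + 8 * 59; k * (n * n) + (s * n + t); M; n * n; k;
       s * n + t; s; t; 64; M + M; m2 12; 1; 1] r.
  by move=> r64 hr; rewrite l4.
exists m5, (139 + (1 + 7 * (M + M) + 11)); split; last 1 first.
- split.
  + by split; rewrite /m5 /= /upd /= ?lo4.
  + by split; rewrite /m5 /= /upd /= ?lo4 //=; clear; lia.
  move=> e he; rewrite -/M.
  have cell y : y < 2 * M -> arr (store_of m5) 0 (2 * M + y) = m0 (5 + y).
    move=> yM; rewrite /= hi5; last by clear; lia.
    (* The first 59 arc ends were saved from registers 5 to 63, the others were copied from address
       64 on. *)
    have [y59|y59] := ltnP y 59.
      rewrite f4; [|clear -y59; lia|by clear -y59 => i; lia].
      rewrite hi; last by clear; lia.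
      have -> : 64 + 8 * (2 * M + y) + 0 = M * 16 + 64 + 8 * y by clear; lia.
      by rewrite v // m1_f.
    have -> : 64 + 8 * (2 * M + y) + 0 = M * 16 + 64 + 8 * 59 + 8 * (y - 59) by clear -y59; lia.
    rewrite v4; last by clear -y59 yM; lia.
    rewrite hi; last by clear -y59 yM; lia.
    rewrite f; [|clear; lia|clear -y59 yM; lia].
    by rewrite m1_f; [congr m0; clear -y59; lia | clear; lia].
  have [a1 a2] := nth_flatten_pairs he.
  rewrite cell; last by clear -he; lia.
  rewrite -addnA cell; last by clear -he; lia.
  by rewrite !m0E a1 a2.
- have -> : size prologue = 139 + 7 + 11 by [].
  apply: (steps_trans G0 sts); exact: (steps_trans G0 st4 stv).
- by clear; lia.
Qed.

(* The registers lie in the output area, so they are overwritten last: register r first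
   gets the address of its final value and then loads through itself. *)
Definition epilogue_head : seq instr :=
  [:: IMul 11 1 2; IConst 1 8; IMul 0 11 1; IConst 3 68; IAdd 0 0 3; IConst 3 512;
      IAdd 10 0 3; IConst 2 64; IConst 13 8; IConst 1 1; IConst 14 1].
Definition ptr_code (a c : nat) : seq instr :=
  flatten [seq [:: IConst 1 (8 * r); IAdd r 0 1] | r <- iota a c].
Definition load_code (a c : nat) : seq instr := [seq ILoad r r | r <- iota a c].
Definition epilogue_tail : seq instr :=
  ptr_code 2 62 ++ [:: IConst 1 8; IAdd 1 0 1] ++ load_code 0 64.
Definition epilogue (l : nat) : seq instr :=
  epilogue_head ++ copy_loop (l + 11) ++ epilogue_tail ++ [:: IHalt].

Lemma ptr_code_ok G a c m :
  1000 <= G -> 2 <= a -> a + c <= 64 ->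
  let m' := exec (ptr_code a c) m in
  [/\ exec_ok G (ptr_code a c) m,
      (forall r, a <= r < a + c -> m' r = m 0 + 8 * r) &
      (forall r, r != 1 -> ~~ (a <= r < a + c) -> m' r = m r)].
Proof.
move=> G1; elim: c a m => [|c IH] a m a2 ac.
  by split=> // r; lia.
rewrite /ptr_code /= -/(ptr_code _ _).
set m1 := upd _ a _.
have e1 : m1 = upd (upd m 1 (8 * a)) a (m 0 + 8 * a) by [].
have fr r : r != 1 -> r != a -> m1 r = m r by rewrite e1 /upd => /negbTE-> /negbTE->.
have [||ok v f] := IH a.+1 m1; [lia|lia|].
split.
- by rewrite ok andbT; lia.
- move=> r hr; have [->|ra] := eqVneq r a.
    by rewrite f ?e1 /upd ?eqxx //; lia.
  by rewrite v ?fr //; lia.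
- by move=> r r1 hr; rewrite f ?fr //; lia.
Qed.

(** All addresses lie beyond the block, so no load disturbs a later one. *)
Lemma load_code_ok G a c m :
  (forall r, a <= r < a + c -> a + c <= m r) ->
  let m' := exec (load_code a c) m in
  [/\ exec_ok G (load_code a c) m,
      (forall r, a <= r < a + c -> m' r = m (m r)) &
      (forall r, ~~ (a <= r < a + c) -> m' r = m r)].
Proof.
elim: c a m => [|c IH] a m h; first by split=> // r; lia.
rewrite /load_code /= -/(load_code _ _).
have fr r : r != a -> upd m a (m (m a)) r = m r by rewrite /upd => /negbTE->.
have [|ok v f] := IH a.+1 (upd m a (m (m a))).
  by move=> r hr; rewrite fr; have := h r; lia.
split=> //.
- move=> r hr; have [->|ra] := eqVneq r a.
    by rewrite f ?/upd ?eqxx //; lia.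
  rewrite v; last by lia.
  rewrite (fr r) // fr //; have := h r hr; lia.
- by move=> r hr; rewrite f ?fr //; lia.
Qed.

Lemma epilogue_ok G P l s m k M :
  1000 <= G -> M <= G -> code_at P l (epilogue l) -> sim s m ->
  var s 1 = k -> var s 2 = M ->
  exists m' T, [/\ steps G P (St l m) T m',
    halted P m', T <= 250 + 7 * (k * M) &
    forall x, x < k * M -> mem m' x = arr s 4 (k * M + x)].
Proof.
move=> G1 MG + [hv ha] hk hM.
have G2 : 1 < G by lia. have G0 : 0 < G by lia.
rewrite /epilogue => /code_at_cat[codeh] /code_at_cat[codel] /code_at_cat[codet codeH].
have h1 : m 1 = k by rewrite hv. have h2 : m 2 = M by rewrite hv.
have okh : exec_ok G epilogue_head m.
  by rewrite /= /upd /= h2; lia.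
have sth := steps_exec G2 codeh okh.
set m1 := exec epilogue_head m in sth.
(* The output starts at cell k|E| of array 4, at address 64 + 8 k|E| + 4. The offset 512 = 8 * 64
   used for the copy skips the 64 values destined for the registers. *)
pose b := k * M * 8 + 68.
have e1 : [/\ m1 0 = b, m1 2 = 64, m1 10 = b + 512, m1 11 = k * M & [/\ m1 1 = 1, m1 13 = 8 & m1 14 = 1]].
  by rewrite /m1 /= /upd /= h1 h2.
have hi1 r : 64 <= r -> m1 r = m r.
  move=> r64; have -> : r = 15 + (r - 15) by lia.
  by [].
case: e1 => a0 a2 a10 a11 [a1 a13 a14].
have [||||m2 [st2 v2 f2 l2]] :=
  copy_loop_ok G2 codel a2 a10 a11 a1 a13 a14; try by lia.
have m20 : m2 0 = b by rewrite l2.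
have [|| ok3 v3 f3] := @ptr_code_ok G 2 62 m2 G1; try by [].
have [m3 em3] : exists m3, exec (ptr_code 2 62) m2 = m3 by exists (exec (ptr_code 2 62) m2).
rewrite em3 in v3 f3.
(* Register 0 holds the base, which is already its own final address; register 1 was scratch space,
   so its address is formed last. *)
pose m4 := exec [:: IConst 1 8; IAdd 1 0 1] m3.
have ok4 : exec_ok G [:: IConst 1 8; IAdd 1 0 1] m3 by rewrite /=; lia.
have m4E r : r < 64 -> m4 r = b + 8 * r.
  move=> r64; case: r r64 => [|[|r]] r64.
  - by rewrite /m4 /= /upd /= f3 // m20; lia.
  - by rewrite /m4 /= /upd /= f3 // m20; lia.
  - by rewrite /m4 /= /upd /= v3 ?m20 //; lia.
have hi4 r : 64 <= r -> m4 r = m2 r.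
  move=> r64; rewrite -f3; [|lia|lia].
  by case: r r64 => [|[|r]].
have [|ok5 v5 f5] := @load_code_ok G 0 64 m4.
  by move=> r hr; rewrite m4E /b; lia.
have [m5 em5] : exists m5, exec (load_code 0 64) m4 = m5 by exists (exec (load_code 0 64) m4).
rewrite em5 in v5 f5.
have okt : exec_ok G epilogue_tail m2.
  by rewrite /epilogue_tail exec_ok_cat ok3 em3 exec_ok_cat ok4 -/m4 ok5.
have stt := steps_exec G2 codet okt.
have et : exec epilogue_tail m2 = m5 by rewrite /epilogue_tail exec_cat em3 exec_cat -/m4 em5.
rewrite et in stt.
set l' := (X in steps _ _ _ _ (St X m5)) in stt.
exists (St l' m5), (11 + (1 + 7 * (k * M) + size epilogue_tail)); split.
- apply: (steps_trans G0 sth); exact: (steps_trans G0 st2 stt).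
- have [iH _] := code_at_cons codeH.
  by rewrite /halted /= /l' iH.
- by rewrite (_ : size epilogue_tail = 190) //; lia.
move=> x xk /=; rewrite -ha //.
have far r : 64 + k * M <= r -> m2 r = m r.
  by move=> hr; rewrite f2 ?hi1 //; [clear -hr; lia|clear -hr; lia|clear -hr => i; lia].
have [x64|x64] := ltnP x 64.
  rewrite v5 // (m4E x) // hi4; last by rewrite /b; lia.
  by rewrite far; [congr m; rewrite /b; lia | rewrite /b; lia].
rewrite f5 ?hi4 //; last by lia.
have -> : x = 64 + 1 * (x - 64) by lia.
rewrite v2; last by lia.
by rewrite hi1; [congr m; rewrite /b; lia | rewrite /b; lia].
Qed.

(** * Building the layered graph *)

Lemma den_skip s : den Skip s = s. Proof. by []. Qed.
Lemma den_asg x e s : den (Asg x e) s = Store (upd (var s) x (ev s e)) (arr s).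
Proof. by []. Qed.
Lemma den_set a e1 e2 s : den (Put a e1 e2) s =
  Store (var s) (fun b => if b == a then upd (arr s a) (ev s e1) (ev s e2) else arr s b).
Proof. by []. Qed.
Lemma den_seq c1 c2 s : den (Seq c1 c2) s = den c2 (den c1 s).
Proof. by []. Qed.
Lemma den_if e c1 c2 s : den (If e c1 c2) s = if ev s e == 0 then den c2 s else den c1 s.
Proof. by []. Qed.
Definition incr (x : nat) : com := Asg x (EAdd (EV x) (EC 1)).
Lemma den_incr x s : den (incr x) s = Store (upd (var s) x (var s x).+1) (arr s).
Proof. by rewrite /incr den_asg /= addn1. Qed.
Lemma den_incr_var x s : var (den (incr x) s) x = (var s x).+1.
Proof. by rewrite den_incr /= /upd eqxx. Qed.
Definition denE := (den_incr, den_skip, den_asg, den_set, den_seq, den_if).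
Lemma den_rep x c s : den (Rep x c) s = iter (var s x) (den c) s.
Proof. by []. Qed.

Opaque den.

(** * Frame rules and nested loops *)

Fixpoint writes_var (c : com) (x : nat) : bool :=
  match c with
  | Asg y _ => x == y
  | Seq c1 c2 | If _ c1 c2 => writes_var c1 x || writes_var c2 x
  | Rep _ c => writes_var c x
  | _ => false
  end.

Fixpoint writes_arr (c : com) (a : nat) : bool :=
  match c with
  | Put b _ _ => a == b
  | Seq c1 c2 | If _ c1 c2 => writes_arr c1 a || writes_arr c2 a
  | Rep _ c => writes_arr c a
  | _ => false
  end.

Lemma den_var c s x : ~~ writes_var c x -> var (den c s) x = var s x.
Proof.
elim: c s => [|y e|a e1 e2|c1 IH1 c2 IH2|e c1 IH1 c2 IH2|y c IH] s //=.
- by rewrite denE /= /upd => /negbTE->.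
- by rewrite negb_or => /andP[h1 h2]; rewrite denE IH2 ?IH1.
- by rewrite negb_or => /andP[h1 h2]; rewrite denE; case: eqP => _; rewrite ?IH1 ?IH2.
- move=> h; rewrite den_rep; move: (var s y) => n.
  by elim: n => //= n IHn; rewrite IH.
Qed.

Lemma den_arr c s a : ~~ writes_arr c a -> arr (den c s) a = arr s a.
Proof.
elim: c s => [|y e|b e1 e2|c1 IH1 c2 IH2|e c1 IH1 c2 IH2|y c IH] s //=.
- by rewrite denE /= => /negbTE->.
- by rewrite negb_or => /andP[h1 h2]; rewrite denE IH2 ?IH1.
- by rewrite negb_or => /andP[h1 h2]; rewrite denE; case: eqP => _; rewrite ?IH1 ?IH2.
- move=> h; rewrite den_rep; move: (var s y) => n.
  by elim: n => //= n IHn; rewrite IH.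
Qed.

Lemma input_den n s t k E c d st : wfc c d -> ~~ writes_arr c 0 ->
  input_ok n s t k E st -> input_ok n s t k E (den c st).
Proof.
move=> w h [[h0 h1 h2] [h3 h4 h5] hE]; split; last by rewrite (den_arr _ h).
  by split; rewrite (den_ro _ w).
by split; rewrite (den_ro _ w).
Qed.

Fixpoint rep (xs : seq nat) (c : com) : com :=
  if xs is x :: xs' then Rep x (rep xs' c) else c.

Lemma wfc_rep xs c d : wfc (rep xs c) d -> exists d', wfc c d'.
Proof. by elim: xs d => [|x xs IH] d /=; [exists d | move=> /and3P[_ _ /IH]]. Qed.

(** Loop bounds are read-only, so nested loops around one body act as a single loop whose number of
    rounds is the product of the bounds, and one counter can index the invariant. *)
Lemma rep_ind xs c d st T (P : nat -> store -> Prop) :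
  T = \prod_(x <- xs) var st x -> wfc (rep xs c) d ->
  P 0 st ->
  (forall i st', i < T -> (forall x, x < 6 -> var st' x = var st x) ->
     P i st' -> P i.+1 (den c st')) ->
  P T (den (rep xs c) st).
Proof.
move=> -> wf P0 PS.
have [d' wc] := wfc_rep wf.
have den_iter : forall st' i, (forall x, x < 6 -> var st' x = var st x) ->
   forall x, x < 6 -> var (iter i (den c) st') x = var st x.
  by move=> st' i h; elim: i => //= i IH x x6; rewrite (den_ro _ wc) ?IH.
suff -> : den (rep xs c) st = iter (\prod_(x <- xs) var st x) (den c) st.
  have : forall i, i <= \prod_(x <- xs) var st x -> P i (iter i (den c) st).
    elim=> // i IH h; rewrite iterS; apply: PS => //; last exact/IH/ltnW.
    exact: den_iter.
  by apply.
have H : forall xs d st', wfc (rep xs c) d -> (forall x, x < 6 -> var st' x = var st x) ->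
    den (rep xs c) st' = iter (\prod_(x <- xs) var st x) (den c) st'.
  elim=> [|x ys IH] e st' /=; first by rewrite big_nil.
  move=> /and3P[x6 _ w] h; rewrite big_cons den_rep h //.
  move: (var st x) => n; elim: n => [|n IHn]; first by rewrite mul0n.
  by rewrite mulSn /= iterD IHn (IH _ _ w) // => y y6; apply: den_iter.
exact: H wf _.
Qed.

Definition cut (nn : nat) (R : nat -> nat) (S : nat -> bool) : nat :=
  \sum_(p < nn) \sum_(q < nn) (S p && ~~ S q) * R (p * nn + q).

Lemma idx_inj nn p q p' q' : q < nn -> q' < nn ->
  (p * nn + q == p' * nn + q') = (p == p') && (q == q').
Proof.
move=> h h'; apply/eqP/andP => [e|[/eqP-> /eqP->]//].
have nn0 : 0 < nn by lia.
have := congr1 (divn^~ nn) e; have := congr1 (modn^~ nn) e.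
by rewrite /= !modnMDl !modn_small // !divnMDl // !divn_small // !addn0 => -> ->; rewrite !eqxx.
Qed.

(** Cuts are linear in each matrix entry; the additive form avoids truncated subtraction. *)
Lemma cut_upd nn R S p q v : p < nn -> q < nn ->
  cut nn (upd R (p * nn + q) v) S + (S p && ~~ S q) * R (p * nn + q) =
  cut nn R S + (S p && ~~ S q) * v.
Proof.
move=> hp hq; rewrite /cut (bigD1 (Ordinal hp)) //= [in RHS](bigD1 (Ordinal hp)) //=.
rewrite (bigD1 (Ordinal hq)) //= [in RHS](bigD1 (Ordinal hq)) //=.
rewrite {1}/upd eqxx.
have -> : \sum_(i < nn | i != Ordinal hq) (S p && ~~ S i) * upd R (p * nn + q) v (p * nn + i)
   = \sum_(i < nn | i != Ordinal hq) (S p && ~~ S i) * R (p * nn + i).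
  apply: eq_bigr => i; rewrite -val_eqE /= => ne.
  by rewrite /upd idx_inj // eqxx /= (negbTE ne).
have -> : \sum_(i < nn | i != Ordinal hp) \sum_(j < nn)
      (S i && ~~ S j) * upd R (p * nn + q) v (i * nn + j)
   = \sum_(i < nn | i != Ordinal hp) \sum_(j < nn) (S i && ~~ S j) * R (i * nn + j).
  apply: eq_bigr => i; rewrite -val_eqE /= => ne; apply: eq_bigr => j _.
  by rewrite /upd idx_inj // (negbTE ne).
set X := \sum_(i < nn | i != Ordinal hq) _; set Y := \sum_(i < nn | i != Ordinal hp) _.
by case: (S p && ~~ S q); rewrite ?mul1n ?mul0n; lia.
Qed.

(* Variables: 0 n, 1 k, 2 |E|, 3 s, 4 t, 5 n + |E| + k + 1; 6 and 7 nodes; 8 arc; 9 layer;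
   10 shift; 11 found; 12 and 13 tail and head found; 14 largest search rank; 15 and 16
   ends of the arc.  Arrays: 0 arcs, 1 residual capacities, 2 search ranks, 3 parents,
   4 output.  Cells of array 0 below 2|E| are unused. *)
Definition eq_expr (a b : expr) : expr :=
  ESub (EC 1) (EAdd (ESub a b) (ESub b a)).
Definition idx_expr (p q : expr) : expr := EAdd (EMul (EMul p 0) 1) q.
Definition node_expr (v i : expr) : expr := EAdd (EMul v 1) i.
Definition src_expr : expr :=
  EGet 0 (EAdd (EAdd (EV 2) (EV 2)) (EAdd (EV 8) (EV 8))).
Definition dst_expr : expr :=
  EGet 0 (EAdd (EAdd (EAdd (EV 2) (EV 2)) (EAdd (EV 8) (EV 8))) (EC 1)).

Lemma ev_eq st a b : ev st (eq_expr a b) = (ev st a == ev st b).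
Proof. by rewrite /=; case: eqP => [->|]; lia. Qed.

Lemma ev_src n s t k E st : input_ok n s t k E st -> var st 8 < size E ->
  ev st src_expr = (arc E (var st 8)).1.
Proof.
move=> [[_ _ h2] _ h] lt; have [<- _] := h _ lt; rewrite /= h2; congr (arr st 0 _); lia.
Qed.

Lemma ev_dst n s t k E st : input_ok n s t k E st -> var st 8 < size E ->
  ev st dst_expr = (arc E (var st 8)).2.
Proof.
move=> [[_ _ h2] _ h] lt; have [_ <-] := h _ lt; rewrite /= h2; congr (arr st 0 _); lia.
Qed.

Lemma ev_idx n s t k E st p q : input_ok n s t k E st ->
  ev st (idx_expr p q) = ev st p * (n * k) + ev st q.
Proof. by move=> [[h0 h1 _] _ _]; rewrite /= h0 h1 mulnA. Qed.

Lemma ev_idx_var n s t k E st x y : input_ok n s t k E st ->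
  ev st (idx_expr (EV x) (EV y)) = var st x * (n * k) + var st y.
Proof. exact: ev_idx. Qed.

Lemma ev_node n s t k E st v i : input_ok n s t k E st ->
  ev st (node_expr v i) = ev st v * k + ev st i.
Proof. by move=> [[_ h1 _] _ _]; rewrite /= h1. Qed.

(** A long input reaches beyond address 63 into the array cells, so the capacity matrix may start
    with nonzero entries. *)
Definition zero_prog : com :=
  Seq (Asg 6 (EC 0)) (rep [:: 0; 1; 0; 1] (Seq (Put 1 (EV 6) (EC 0)) (incr 6))).

Lemma zero_ok n s t k E st S : input_ok n s t k E st ->
  cut (n * k) (arr (den zero_prog st) 1) S = 0.
Proof.
move=> [[h0 h1 _] _ _].
pose P i (st : store) := var st 6 = i /\ forall p, p < i -> arr st 1 p = 0.
have [_ z] : P (n * k * (n * k)) (den zero_prog st).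
  rewrite /zero_prog den_seq; apply: (@rep_ind _ _ 0).
  - by rewrite !big_cons big_nil denE /= /upd /= h0 h1; lia.
  - by [].
  - by split=> //; rewrite denE.
  move=> i st' _ _ [v6 z]; split; rewrite !denE /= /upd /= v6 // => p pi.
  by case: eqP => // ne; apply: z; lia.
rewrite /cut big1 // => p _; rewrite big1 // => q _; rewrite z ?muln0 //.
by have := ltn_ord p; have := ltn_ord q; nia.
Qed.

(** The guard k - (i + j) is nonzero exactly when i + j < k. Capacities are accumulated, so one
    execution adds one summand of [layered_cut] to the cut. *)
Definition arc_body (w : expr) : com :=
  Seq (If (ESub (EV 1) (EAdd (EV 9) (EV 10)))
         (Seq (Asg 6 (node_expr (EV 15) (EV 9)))
         (Seq (Asg 7 (node_expr (EV 16) (EAdd (EV 9) (EV 10))))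
              (Put 1 (idx_expr (EV 6) (EV 7))
                 (EAdd (EGet 1 (idx_expr (EV 6) (EV 7))) w))))
         Skip)
      (incr 10).
Definition shift_loop (w : expr) : com := Seq (Asg 10 (EC 0)) (rep [:: 1] (arc_body w)).
Definition layer_loop (w : expr) : com :=
  Seq (Asg 9 (EC 0)) (rep [:: 1] (Seq (shift_loop w) (incr 9))).
Definition build_prog (w : expr) : com :=
  Seq (Asg 8 (EC 0)) (rep [:: 2]
    (Seq (Asg 15 src_expr) (Seq (Asg 16 dst_expr) (Seq (layer_loop w) (incr 8))))).

(** Depth 2 is where [arc_body] evaluates the weight, as right summand of the value to be
    written. *)
Definition weight_expr (w : expr) (W : nat -> nat -> nat -> nat) : Prop :=
  wfe w 2 /\ forall n s t k E st, input_ok n s t k E st ->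
    ev st w = W (size E) k (var st 10).

Definition w_sum_expr : expr :=
  EAdd (EMul (EMul (EMul (ESub (EC 1) (EV 10)) 2) 1) 1) (EC 1).
Definition w_cov_expr : expr :=
  EAdd (EMul (EMul (EMul (ESub (EC 1) (EV 10)) 2) 1) 1)
    (ESub (EC 1) (ESub (EV 10) (EC 1))).

Lemma w_sum_exprP : weight_expr w_sum_expr w_sum.
Proof. by split=> // n s t k E st [[_ h1 h2] _ _]; rewrite /= h1 h2. Qed.
Lemma w_cov_exprP : weight_expr w_cov_expr w_cov.
Proof. by split=> // n s t k E st [[_ h1 h2] _ _]; rewrite /= h1 h2. Qed.

Lemma node_lt n k v i : v < n -> i < k -> v * k + i < n * k.
Proof. by move=> *; nia. Qed.

Definition arc_weight (W : nat -> nat) k u v i (S : nat -> bool) j : nat :=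
  (i + j < k) * (W j * (S (u * k + i) && ~~ S (v * k + (i + j)))).

Lemma shift_loop_ok n s t k E st w W S : weight_expr w W ->
  input_ok n s t k E st ->
  var st 15 < n -> var st 16 < n -> var st 9 < k ->
  cut (n * k) (arr (den (shift_loop w) st) 1) S =
  cut (n * k) (arr st 1) S +
  \sum_(0 <= j < k) arc_weight (W (size E) k) k (var st 15) (var st 16) (var st 9) S j.
Proof.
move=> [ww wE] inp un vn ik.
set u := var st 15 in un *; set v := var st 16 in vn *; set i := var st 9 in ik *.
pose P j (st' : store) := [/\ input_ok n s t k E st', var st' 10 = j,
  [/\ var st' 15 = u, var st' 16 = v & var st' 9 = i] &
  cut (n * k) (arr st' 1) S = cut (n * k) (arr st 1) S +
    \sum_(0 <= j' < j) arc_weight (W (size E) k) k u v i S j'].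
have inp0 := @input_den _ _ _ _ _ (Asg 10 (EC 0)) 0 st isT isT inp.
have wb : wfc (arc_body w) 1 by rewrite /= ww.
suff [_ _ _ ->] : P k (den (shift_loop w) st) by [].
rewrite /shift_loop den_seq; apply: (@rep_ind _ _ 0).
- by rewrite big_cons big_nil muln1; case: inp0 => -[_ -> _] _ _.
- by rewrite /= ww.
- by split=> //; rewrite denE big_geq // addn0.
move=> j st' jk _ [inp' h10 [h15 h16 h9] hc]; split.
- exact: input_den wb isT inp'.
- by rewrite denE denE /= /upd /= den_if; case: eqP => _; rewrite !denE /= /upd /= h10.
- by rewrite !(den_var) //.
have h1 : var st' 1 = k by case: inp' => -[].
rewrite den_seq den_arr // den_if /= h1 h9 h10 big_nat_recr //= addnA -hc.
rewrite /arc_weight; case: ltnP => ijk; last first.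
  have -> : k - (i + j) == 0 by lia.
  by rewrite mul0n addn0.
have -> : k - (i + j) == 0 = false by lia.
set a1 := Asg 6 _; set a2 := Asg 7 _.
rewrite !den_seq den_set.
set st2 := den a2 (den a1 st').
have inp2 : input_ok n s t k E st2.
  by apply: (@input_den _ _ _ _ _ _ 0) => //; apply: (@input_den _ _ _ _ _ _ 0).
have e6 : var st2 6 = u * k + i by rewrite /st2 !denE /= /upd /= h1 h15 h9.
have e7 : var st2 7 = v * k + (i + j) by rewrite /st2 !denE /= /upd /= h1 h16 h9 h10.
have e10 : var st2 10 = j by rewrite /st2 !denE.
have ea : arr st2 1 = arr st' 1 by rewrite /st2 !denE.
set idx := idx_expr _ _.
have ei : ev st2 idx = (u * k + i) * (n * k) + (v * k + (i + j)).
  by rewrite (ev_idx _ _ inp2) /= e6 e7.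
have ew : ev st2 (EAdd (EGet 1 idx) w) =
    arr st' 1 ((u * k + i) * (n * k) + (v * k + (i + j))) + W (size E) k j.
  by rewrite -ei -ea -e10 -(wE _ _ _ _ _ _ inp2).
rewrite -[arr (Store _ _) 1]/(upd (arr st2 1) (ev st2 idx) (ev st2 (EAdd (EGet 1 idx) w))).
rewrite ei ew ea.
have := @cut_upd (n * k) (arr st' 1) S (u * k + i) (v * k + (i + j))
  (arr st' 1 ((u * k + i) * (n * k) + (v * k + (i + j))) + W (size E) k j)
  (node_lt un ik) (node_lt vn ijk).
by case: (S (u * k + i) && _); rewrite ?mul1n ?muln1 ?mul0n ?muln0; lia.
Qed.

Lemma layer_loop_ok n s t k E st w W S : weight_expr w W ->
  input_ok n s t k E st -> var st 15 < n -> var st 16 < n ->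
  cut (n * k) (arr (den (layer_loop w) st) 1) S =
  cut (n * k) (arr st 1) S + \sum_(0 <= i < k) \sum_(0 <= j < k)
    arc_weight (W (size E) k) k (var st 15) (var st 16) i S j.
Proof.
move=> wW inp un vn; have [ww _] := wW.
set u := var st 15 in un *; set v := var st 16 in vn *.
pose P i (st' : store) := [/\ input_ok n s t k E st', var st' 9 = i,
  var st' 15 = u /\ var st' 16 = v &
  cut (n * k) (arr st' 1) S = cut (n * k) (arr st 1) S +
    \sum_(0 <= i' < i) \sum_(0 <= j < k) arc_weight (W (size E) k) k u v i' S j].
have inp0 := @input_den _ _ _ _ _ (Asg 9 (EC 0)) 0 st isT isT inp.
suff [_ _ _ ->] : P k (den (layer_loop w) st) by [].
rewrite /layer_loop den_seq; apply: (@rep_ind _ _ 0).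
- by rewrite big_cons big_nil muln1; case: inp0 => -[_ -> _] _ _.
- by rewrite /= ww.
- by split=> //; rewrite denE // big_geq // addn0.
move=> i st' ik _ [inp' h9 [h15 h16] hc]; split.
- by apply: (@input_den _ _ _ _ _ _ 1) inp'; rewrite //= ww.
- by rewrite denE den_incr_var den_var // h9.
- by rewrite !den_var.
rewrite den_seq den_arr // (shift_loop_ok _ wW inp') ?h15 ?h16 ?h9 //.
by rewrite hc big_nat_recr //= addnA.
Qed.

(** The matrix is specified through its cuts alone, which is all that the flow algorithm is later
    given about it. *)
Lemma build_prog_ok n s t k E st w W S : weight_expr w W ->
  all (fun e : nat * nat => (e.1 < n) && (e.2 < n)) E ->
  input_ok n s t k E st ->
  cut (n * k) (arr (den (build_prog w) st) 1) S =
  cut (n * k) (arr st 1) S +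
  layered_cut (W (size E) k) k E (fun v i => S (v * k + i)).
Proof.
move=> wW allE inp; have [ww _] := wW.
pose term e := \sum_(0 <= i < k) \sum_(0 <= j < k)
    arc_weight (W (size E) k) k (arc E e).1 (arc E e).2 i S j.
have -> : layered_cut (W (size E) k) k E (fun v i => S (v * k + i)) =
  \sum_(0 <= e < size E) term e.
  rewrite /layered_cut big_mkord; apply: eq_bigr => e _; rewrite /term big_mkord.
  by apply: eq_bigr => i _; rewrite big_mkord.
pose P e (st' : store) := [/\ input_ok n s t k E st', var st' 8 = e &
  cut (n * k) (arr st' 1) S = cut (n * k) (arr st 1) S + \sum_(0 <= e' < e) term e'].
have inp0 := @input_den _ _ _ _ _ (Asg 8 (EC 0)) 0 st isT isT inp.
suff [_ _ ->] : P (size E) (den (build_prog w) st) by [].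
rewrite /build_prog den_seq; apply: (@rep_ind _ _ 0).
- by rewrite big_cons big_nil muln1; case: inp0 => -[_ _ ->] _ _.
- by rewrite /= ww.
- by split=> //; rewrite denE // big_geq // addn0.
move=> e st' eE _ [inp' h8 hc].
split.
- by apply: (@input_den _ _ _ _ _ _ 1) inp'; rewrite //= ww.
- by rewrite !den_seq den_incr_var !den_var // h8.
have /andP[un vn] : ((arc E e).1 < n) && ((arc E e).2 < n).
  by apply: (allP allE); rewrite mem_nth.
rewrite 3!den_seq den_arr //.
set st2 := den _ (den _ st').
have inp2 : input_ok n s t k E st2.
  by apply: (@input_den _ _ _ _ _ _ 0) => //; apply: (@input_den _ _ _ _ _ _ 0).
have inp1 : input_ok n s t k E (den (Asg 15 src_expr) st').
  by apply: (@input_den _ _ _ _ _ _ 0).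
have h15 : var st2 15 = (arc E e).1.
  rewrite /st2 den_var // den_asg -[LHS]/(ev st' src_expr).
  by rewrite (ev_src inp') h8.
have h16 : var st2 16 = (arc E e).2.
  rewrite /st2 den_asg -[LHS]/(ev (den (Asg 15 src_expr) st') dst_expr).
  by rewrite (ev_dst inp1) den_var ?h8.
rewrite (layer_loop_ok _ wW inp2) ?h15 ?h16 // big_nat_recr //= addnA -hc.
by rewrite /st2 !den_arr.
Qed.

(** * Augmenting paths *)

Definition reset_prog : com :=
  Seq (Asg 14 (EC 1)) (Seq (Asg 6 (EC 0))
    (rep [:: 0; 1] (Seq (Put 2 (EV 6) (eq_expr (EDiv (EV 6) (EV 1)) (EV 3))) (incr 6)))).

(** Loops cannot be left early, so a scan goes through all pairs and keeps the last residual arc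
    found from a visited to an unvisited node. *)
Definition scan_inner : com :=
  If (EGet 2 (EV 7)) Skip
    (If (EGet 1 (idx_expr (EV 6) (EV 7)))
       (Seq (Asg 11 (EC 1)) (Seq (Asg 12 (EV 6)) (Asg 13 (EV 7)))) Skip).
Definition scan_row : com :=
  Seq (Asg 7 (EC 0)) (rep [:: 0; 1] (Seq scan_inner (incr 7))).
Definition scan_prog : com :=
  Seq (Asg 11 (EC 0)) (Seq (Asg 6 (EC 0))
    (rep [:: 0; 1] (Seq (If (EGet 2 (EV 6)) scan_row Skip) (incr 6)))).

(** On reaching a copy of s the walk idles for the remaining rounds. A path is augmented by one unit
    only. *)
Definition walk_body : com :=
  If (eq_expr (EDiv (EV 7) (EV 1)) (EV 3)) Skip
    (Seq (Asg 6 (EGet 3 (EV 7)))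
    (Seq (Put 1 (idx_expr (EV 6) (EV 7)) (ESub (EGet 1 (idx_expr (EV 6) (EV 7))) (EC 1)))
    (Seq (Put 1 (idx_expr (EV 7) (EV 6)) (EAdd (EGet 1 (idx_expr (EV 7) (EV 6))) (EC 1)))
         (Asg 7 (EV 6))))).
Definition walk_prog : com := Seq (Asg 7 (EV 13)) (rep [:: 0; 1] walk_body).

Definition mark_prog : com :=
  Seq (incr 14) (Seq (Put 2 (EV 13) (EV 14)) (Put 3 (EV 13) (EV 12))).

Definition flow_body : com :=
  Seq scan_prog (If (EV 11)
    (Seq mark_prog
      (If (eq_expr (EDiv (EV 13) (EV 1)) (EV 4)) (Seq walk_prog reset_prog) Skip))
    Skip).

(* The ninth power of n + |E| + k + 1 exceeds the number of search steps. *)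
Definition flow_prog : com := Seq reset_prog (rep [:: 5; 5; 5; 5; 5; 5; 5; 5; 5] flow_body).

(* [vis p] is 0 for an unvisited node and otherwise a rank decreasing along
   parents, so following parents ends in a source. *)
Definition search_tree (nn k s : nat) (R vis par : nat -> nat) (cnt : nat) : Prop :=
  [/\ forall p, p < nn -> p %/ k == s -> 0 < vis p,
      forall p, p < nn -> 0 < vis p -> p %/ k != s ->
        [/\ par p < nn, 0 < vis (par p) < vis p & 0 < R (par p * nn + p)],
      forall p, p < nn -> vis p <= cnt &
      cnt <= \sum_(p < nn) (0 < vis p)].

Definition valid (nn k s t : nat) (S : nat -> bool) : Prop :=
  (forall p, p < nn -> p %/ k == s -> S p) /\ (forall p, p < nn -> p %/ k == t -> ~~ S p).

Definition closed (nn : nat) (R vis : nat -> nat) : Prop :=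
  forall p q, p < nn -> q < nn -> 0 < vis p -> vis q = 0 -> R (p * nn + q) = 0.

Lemma count_le nn (vis : nat -> nat) : \sum_(p < nn) (0 < vis p) <= nn.
Proof.
rewrite -[leqRHS]card_ord -sum1_card; apply: leq_sum => i _; exact: leq_b1.
Qed.

Lemma input_nn n s t k E st xs : input_ok n s t k E st -> xs = [:: 0; 1] ->
  n * k = \prod_(x <- xs) var st x.
Proof. by move=> [[h0 h1 _] _ _] ->; rewrite !big_cons big_nil h0 h1 muln1. Qed.

(** Pushing one unit along the arc from p to q changes the cut of S by [S q] - [S p]. Over a path
    these differences telescope; its ends, a copy of s inside S and a copy of t outside, leave
    -1. *)
Lemma walk_ok n s t k E st S : input_ok n s t k E st -> s != t ->
  search_tree (n * k) k s (arr st 1) (arr st 2) (arr st 3) (var st 14) ->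
  var st 13 < n * k -> 0 < arr st 2 (var st 13) -> var st 13 %/ k == t ->
  valid (n * k) k s t S ->
  cut (n * k) (arr (den walk_prog st) 1) S + 1 = cut (n * k) (arr st 1) S.
Proof.
set nn := n * k => inp st_ [h1 h2 h3 h4] q0 v0 q0t [vs vt].
set vis := arr st 2 in h1 h2 h3 h4 v0 *; set par := arr st 3 in h2 *.
(* Ranks are positive, at most nn, and drop in every round before a source is reached; so nn rounds
   suffice. The tree arcs still ahead keep positive residual capacity. *)
pose P i (st' : store) := [/\ input_ok n s t k E st',
  arr st' 2 = vis /\ arr st' 3 = par,
  [/\ var st' 7 < nn, 0 < vis (var st' 7) &
      (var st' 7 %/ k == s) || (vis (var st' 7) + i <= nn)],
  forall x, x < nn -> 0 < vis x -> x %/ k != s -> vis x <= vis (var st' 7) ->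
    0 < arr st' 1 (par x * nn + x) &
  cut nn (arr st' 1) S + S (var st' 7) = cut nn (arr st 1) S].
have inp0 := @input_den _ _ _ _ _ (Asg 7 (EV 13)) 0 st isT isT inp.
have [_ _ [p1 p2 p3] _ p5] : P nn (den walk_prog st).
  rewrite /walk_prog den_seq; apply: (@rep_ind _ _ 0).
  - exact: input_nn inp0 _.
  - by [].
  - split=> //; rewrite !denE /= /upd /=.
    + split=> //; apply/orP; right; rewrite addn0.
      by apply: leq_trans (h3 _ q0) _; apply: leq_trans h4 (count_le _ _).
    + by move=> x xn vx xs _; have [_ _] := h2 x xn vx xs.
    + by rewrite (negbTE (vt _ q0 q0t)) addn0.
  move=> i st' ilt _ [inp' [e2 e3] [q1 q2 q3] rp hc].
  have h1' : var st' 1 = k by case: inp' => -[].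
  have h3' : var st' 3 = s by case: inp' => _ [].
  have inp'' := @input_den _ _ _ _ _ walk_body 0 st' isT isT inp'.
  set q := var st' 7 in q1 q2 q3 rp hc.
  have ecase : ev st' (eq_expr (EDiv (EV 7) (EV 1)) (EV 3)) = (q %/ k == s).
    by rewrite ev_eq /= h1' h3'.
  have [qs|qs] := boolP (q %/ k == s).
    have -> : den walk_body st' = st' by rewrite /walk_body den_if ecase qs.
    by split=> //; split=> //; rewrite -/q qs.
  rewrite (negbTE qs) /= in q3.
  have [pn /andP[vp pq] _] := h2 q q1 q2 qs.
  set p := par q in pn vp pq.
  set a1 := Asg 6 (EGet 3 (EV 7)).
  set i1 := idx_expr (EV 6) (EV 7); set i2 := idx_expr (EV 7) (EV 6).
  set a2 := Put 1 i1 (ESub (EGet 1 i1) (EC 1)).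
  set a3 := Put 1 i2 (EAdd (EGet 1 i2) (EC 1)).
  have e4 : den walk_body st' = den (Asg 7 (EV 6)) (den a3 (den a2 (den a1 st'))).
    by rewrite /walk_body den_if ecase (negbTE qs).
  set st1 := den a1 st' in e4; set st2 := den a2 st1 in e4; set st3 := den a3 st2 in e4.
  have inp1 : input_ok n s t k E st1 by apply: (@input_den _ _ _ _ _ _ 0).
  have inp2 : input_ok n s t k E st2 by apply: (@input_den _ _ _ _ _ _ 0).
  have v61 : var st1 6 = p by rewrite /st1 den_asg /= /upd /= e3.
  have v71 : var st1 7 = q by rewrite /st1 den_var.
  have v62 : var st2 6 = p by rewrite /st2 den_var.
  have v72 : var st2 7 = q by rewrite /st2 den_var.
  have v63 : var st3 6 = p by rewrite /st3 den_var.
  set R := arr st' 1 in rp hc.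
  have r1 : arr st1 1 = R by rewrite /st1 den_arr.
  have ei1 : ev st1 i1 = p * nn + q by rewrite (ev_idx_var _ _ inp1) v61 v71.
  have ei2 : ev st2 i2 = q * nn + p by rewrite (ev_idx_var _ _ inp2) v62 v72.
  have r2 : arr st2 1 = upd R (p * nn + q) (R (p * nn + q) - 1).
    have -> : arr st2 1 = upd (arr st1 1) (ev st1 i1) (arr st1 1 (ev st1 i1) - 1).
      by rewrite /st2 den_set.
    by rewrite ei1 r1.
  set R2 := upd R _ _ in r2.
  have r3 : arr st3 1 = upd R2 (q * nn + p) (R2 (q * nn + p) + 1).
    have -> : arr st3 1 = upd (arr st2 1) (ev st2 i2) (arr st2 1 (ev st2 i2) + 1).
      by rewrite /st3 den_set.
    by rewrite ei2 r2.
  have r4 : arr (den walk_body st') 1 = arr st3 1 by rewrite e4 den_arr.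
  have v4 : var (den walk_body st') 7 = p by rewrite e4 den_asg.
  have Rpos : 0 < R (p * nn + q) by apply: rp.
  split.
  - exact: inp''.
  - by rewrite !den_arr.
  - rewrite v4; split=> //; apply/orP; right.
    by apply: leq_trans q3; rewrite addnS -addSn leq_add2r.
  - rewrite v4 r4 r3 => x xn vx xs xp.
    (* As q has larger rank than p, the lowered entry belongs to no tree arc still ahead; the other
       changed entry only increases. *)
    have xq : x != q by apply: contraTneq xp => ->; lia.
    rewrite /upd idx_inj //; case: ifP => _; first by rewrite addn1.
    rewrite /R2 /upd idx_inj // (negbTE xq) andbF; apply: rp => //.
    exact: leq_trans xp (ltnW pq).
  - rewrite v4 r4 r3 -hc.
    have := @cut_upd nn R2 S q p (R2 (q * nn + p) + 1) q1 pn.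
    have := @cut_upd nn R S p q (R (p * nn + q) - 1) pn q1.
    rewrite -/R2; move: (R2 _) (R _) Rpos => x y y0.
    by case: (S p); case: (S q); rewrite /= ?mul1n ?mul0n; lia.
have sq : var (den walk_prog st) 7 %/ k == s by case/orP: p3 => //; lia.
by rewrite -p5 (vs _ p1 sq).
Qed.

Lemma reset_ok n s t k E st : input_ok n s t k E st -> s < n -> s != t -> 0 < k ->
  let st' := den reset_prog st in
  [/\ input_ok n s t k E st', arr st' 1 = arr st 1,
      search_tree (n * k) k s (arr st' 1) (arr st' 2) (arr st' 3) (var st' 14),
      forall p, p < n * k -> p %/ k == t -> arr st' 2 p = 0 & 0 < var st' 14].
Proof.
move=> inp sn st_ k0 fin; rewrite {}/fin.
have inp' : input_ok n s t k E (den reset_prog st) by apply: (@input_den _ _ _ _ _ _ 0).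
pose P i (st' : store) := [/\ input_ok n s t k E st', var st' 6 = i, var st' 14 = 1 &
  forall p, p < i -> arr st' 2 p = (p %/ k == s)].
have [_ _ c1 hv] : P (n * k) (den reset_prog st).
  rewrite /reset_prog 2!den_seq; set st0 := den _ (den _ st).
  have inp0 : input_ok n s t k E st0.
    by apply: (@input_den _ _ _ _ _ _ 0) => //; apply: (@input_den _ _ _ _ _ _ 0).
  apply: (@rep_ind _ _ 0).
  - exact: input_nn inp0 _.
  - by [].
  - by split=> //; rewrite /st0 !denE.
  move=> i st' _ _ [inp1 h6 h14 h]; split.
  - exact: (@input_den _ _ _ _ _ _ 0).
  - by rewrite den_seq den_incr_var den_var // h6.
  - by rewrite den_var.
  rewrite den_seq den_arr // den_set => p.
  have -> : arr (Store (var st') (fun b => if b == 2 then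
     upd (arr st' 2) (ev st' (EV 6)) (ev st' (eq_expr (EDiv (EV 6) (EV 1)) (EV 3)))
     else arr st' b)) 2 p =
     upd (arr st' 2) (ev st' (EV 6)) (ev st' (eq_expr (EDiv (EV 6) (EV 1)) (EV 3))) p by [].
  rewrite ev_eq /= h6; case: inp1 => -[_ -> _] [-> _ _] _.
  by rewrite ltnS leq_eqVlt /upd; case: eqP => [->|_] //= /h.
have ar : arr (den reset_prog st) 1 = arr st 1 by rewrite den_arr.
split=> //; last by rewrite c1.
  split.
  - by move=> p pn ps; rewrite hv // ps.
  - by move=> p pn; rewrite hv //; case: (_ == s).
  - by move=> p pn; rewrite hv // c1 leq_b1.
  (* The node (s, 0) shows that at least one node is visited. *)
  - have sk : s * k < n * k by nia.
    rewrite c1 (bigD1 (Ordinal sk)) //= hv // mulnK //.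
    by rewrite eqxx.
move=> p pn /eqP pt; rewrite hv // pt.
by rewrite eq_sym (negbTE st_).
Qed.

Lemma scan_ok n s t k E st : input_ok n s t k E st ->
  let st' := den scan_prog st in
  (var st' 11 = 0 /\ closed (n * k) (arr st 1) (arr st 2)) \/
  [/\ 0 < var st' 11, var st' 12 < n * k, var st' 13 < n * k,
      0 < arr st 2 (var st' 12) &
      arr st 2 (var st' 13) = 0 /\
      0 < arr st 1 (var st' 12 * (n * k) + var st' 13)].
Proof.
set nn := n * k => inp fin; rewrite {}/fin.
set R := arr st 1; set vis := arr st 2.
pose good (st' : store) := [/\ 0 < var st' 11, var st' 12 < nn, var st' 13 < nn,
      0 < vis (var st' 12) &
      vis (var st' 13) = 0 /\ 0 < R (var st' 12 * nn + var st' 13)].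
pose base (st' : store) := [/\ input_ok n s t k E st', arr st' 1 = R & arr st' 2 = vis].
have basE c st' : wfc c 3 -> ~~ writes_arr c 0 -> ~~ writes_arr c 1 -> ~~ writes_arr c 2 ->
    base st' -> base (den c st').
  move=> w w0 w1 w2 [b1 b2 b3]; split; rewrite ?den_arr //.
  exact: (input_den w w0).
have goodE c st' : ~~ writes_var c 11 -> ~~ writes_var c 12 -> ~~ writes_var c 13 ->
    good st' -> good (den c st').
  by move=> w11 w12 w13; rewrite /good !den_var.
(* Here b is the flag at the start of the row; b = 0 in the second alternative excludes that an arc
   found in an earlier row gets lost. *)
pose Q b p j (st' : store) := [/\ base st', var st' 6 = p, var st' 7 = j &
  good st' \/ (b = 0 /\ var st' 11 = 0 /\ forall q, q < j -> vis q = 0 -> R (p * nn + q) = 0)].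
have row p st' : p < nn -> 0 < vis p -> base st' -> var st' 6 = p ->
    good st' \/ var st' 11 = 0 -> Q (var st' 11) p nn (den scan_row st').
  move=> pn vp bs h6 gd; rewrite /scan_row den_seq.
  have bs0 := basE (Asg 7 (EC 0)) st' isT isT isT isT bs.
  apply: (@rep_ind _ _ 0).
  - case: bs0 => inp0 _ _; exact: input_nn inp0 _.
  - by [].
  - split=> //; rewrite ?denE //.
    case: gd => [g|z]; last by right.
    by left; apply: (goodE (Asg 7 (EC 0))).
  move=> j st1 jn _ [bs1 h61 h71 g1].
  have bs2 := basE scan_inner st1 isT isT isT isT bs1.
  have bs3 := basE (Seq scan_inner (incr 7)) st1 isT isT isT isT bs1.
  split=> //.
  - by rewrite den_var.
  - by rewrite den_seq den_incr_var den_var // h71.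
  rewrite den_seq.
  suff [g|[b0 [z h]]] : good (den scan_inner st1) \/
     (var st' 11 = 0 /\ var (den scan_inner st1) 11 = 0 /\ forall q, q < j.+1 -> vis q = 0 -> R (p * nn + q) = 0).
  + by left; apply: goodE.
  + by right; rewrite den_var.
  case: bs1 => inp1 r1 v1.
  rewrite /scan_inner den_if.
  have -> : ev st1 (EGet 2 (EV 7)) = vis j by rewrite /= h71 v1.
  case: eqP => [vj|vj]; last first.
    rewrite den_skip; case: g1 => [|[b0 [z h]]]; [by left|right; do 2!split=> //; move=> q].
    by rewrite ltnS leq_eqVlt => /orP[/eqP-> //|]; exact: h.
  rewrite den_if.
  have -> : ev st1 (EGet 1 (idx_expr (EV 6) (EV 7))) = R (p * nn + j).
    rewrite -[LHS]/(arr st1 1 (ev st1 (idx_expr (EV 6) (EV 7)))).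
    by rewrite (ev_idx_var _ _ inp1) h61 h71 r1.
  case: eqP => [rj|/eqP rj].
    rewrite den_skip; case: g1 => [|[b0 [z h]]]; [by left|right; do 2!split=> //; move=> q].
    by rewrite ltnS leq_eqVlt => /orP[/eqP-> //|]; exact: h.
  by left; rewrite !denE /good /= /upd /= h61 h71 [0 < R _]lt0n rj; split=> //.
pose P i (st' : store) := [/\ base st', var st' 6 = i &
  good st' \/ (var st' 11 = 0 /\
    forall p q, p < i -> q < nn -> 0 < vis p -> vis q = 0 -> R (p * nn + q) = 0)].
suff [_ _ [g|[z h]]] : P nn (den scan_prog st).
- by right.
- by left; split=> // p q pn qn; apply: h.
rewrite /scan_prog 2!den_seq.
have bs0 : base (den (Asg 6 (EC 0)) (den (Asg 11 (EC 0)) st)).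
  by apply: basE => //; apply: basE.
apply: (@rep_ind _ _ 0).
- case: (bs0) => inp0 _ _; exact: input_nn inp0 _.
- by [].
- by split=> //; rewrite ?denE //; right.
move=> p st1 pn _ [bs1 h6 g1].
set c := If _ _ _.
have bs3 := basE (Seq c (incr 6)) st1 isT isT isT isT bs1.
split=> //; first by rewrite den_seq den_incr_var den_var // h6.
rewrite den_seq.
suff [g|[z h]] : good (den c st1) \/
   (var (den c st1) 11 = 0 /\ forall p' q, p' < p.+1 -> q < nn -> 0 < vis p' ->
      vis q = 0 -> R (p' * nn + q) = 0).
+ by left; apply: goodE.
+ by right; rewrite den_var.
rewrite /c den_if.
have -> : ev st1 (EGet 2 (EV 6)) = vis p by case: bs1 => _ _ v1; rewrite /= h6 v1.
case: eqP => [vp|/eqP]; last rewrite -lt0n => vp.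
  rewrite den_skip; case: g1 => [|[z h]]; [by left|right; split=> // p' q].
  by rewrite ltnS leq_eqVlt => /orP[/eqP->|]; [rewrite vp|exact: h].
have [|_ _ _ [g|[b0 [z h]]]] := row p st1 pn vp bs1 h6.
- by case: g1 => [|[]]; [left|right].
- by left.
case: g1 => [g|[z1 h1]].
  by case: g; rewrite b0.
right; split=> // p' q; rewrite ltnS leq_eqVlt => /orP[/eqP->|]; last exact: h1.
by move=> qn _; exact: h.
Qed.

(** The new rank exceeds all earlier ones, and q, being unvisited, is not the parent of a visited
    non-source node, so the old tree arcs survive. *)
Lemma search_tree_extend nn k s R vis par cnt p q :
  search_tree nn k s R vis par cnt -> p < nn -> q < nn ->
  0 < vis p -> vis q = 0 -> 0 < R (p * nn + q) ->
  search_tree nn k s R (upd vis q cnt.+1) (upd par q p) cnt.+1.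
Proof.
move=> [h1 h2 h3 h4] pn qn vp vq Rpq; rewrite /upd; split.
- by move=> x xn xs; case: eqP => // _; apply: h1.
- move=> x xn; case: eqP => [-> _ _|xq vx xs].
    rewrite ifN; last by apply: contraTneq vp => ->; rewrite vq.
    by rewrite ltnS vp h3.
  have [pxn /andP[v1 v2] Rx] := h2 x xn vx xs; split=> //.
  rewrite ifN; last by apply: contraTneq v1 => ->; rewrite vq.
  by rewrite v1.
- by move=> x xn; case: eqP => // _; apply: leqW; apply: h3.
- rewrite (bigD1 (Ordinal qn)) //= eqxx add1n ltnS.
  apply: leq_trans h4 _; rewrite (bigD1 (Ordinal qn)) //= vq add0n.
  apply: leq_sum => x; rewrite -val_eqE /= => /negbTE-> //.
Qed.

(** T counts the augmentations, and C0 gives the cuts under the initial capacities. *)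
Definition flow_inv n s t k E (C0 : (nat -> bool) -> nat) T st : Prop :=
  [/\ input_ok n s t k E st,
      search_tree (n * k) k s (arr st 1) (arr st 2) (arr st 3) (var st 14),
      forall p, p < n * k -> p %/ k == t -> arr st 2 p = 0,
      0 < var st 14 &
      forall S, valid (n * k) k s t S -> cut (n * k) (arr st 1) S + T = C0 S].

Lemma flow_inv_den n s t k E C0 T st c d : wfc c d ->
  ~~ [|| writes_arr c 0, writes_arr c 1, writes_arr c 2, writes_arr c 3 | writes_var c 14] ->
  flow_inv n s t k E C0 T st -> flow_inv n s t k E C0 T (den c st).
Proof.
rewrite !negb_or => w /and5P[a0 a1 a2 a3 v] [h1 h2 h3 h4 h5].
by split; rewrite ?den_arr ?den_var //; exact: input_den w a0 h1.
Qed.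

(** A lexicographic measure: the rank counter stays between 1 and nk, so an augmentation outweighs
    the restart of the search. *)
Definition progress n k T (st : store) : nat := T * (n * k).+1 + var st 14.

(** A round that finds no arc leaves the search stuck; any other marks a node, and augments if that
    node is a copy of t. Including that the search was not stuck before makes being stuck
    permanent. *)
Lemma flow_body_ok n s t k E C0 T st : s < n -> s != t -> 0 < k ->
  flow_inv n s t k E C0 T st ->
  exists T', flow_inv n s t k E C0 T' (den flow_body st) /\
   (closed (n * k) (arr (den flow_body st) 1) (arr (den flow_body st) 2) \/
    ~ closed (n * k) (arr st 1) (arr st 2) /\
    progress n k T st < progress n k T' (den flow_body st)).
Proof.
move=> sn st_ k0 inv; have [inp tree snk cnt0 hcut] := inv.
have := scan_ok inp.
rewrite /flow_body den_seq.
have inv1 := @flow_inv_den _ _ _ _ _ _ _ _ scan_prog 0 isT isT inv.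
have a1 : arr (den scan_prog st) 1 = arr st 1 by rewrite den_arr.
have a2 : arr (den scan_prog st) 2 = arr st 2 by rewrite den_arr.
have c1 : var (den scan_prog st) 14 = var st 14 by rewrite den_var.
rewrite -a1 -a2 /progress -c1; move: (den scan_prog st) inv1 => {inv inp tree snk cnt0 hcut a1 a2 c1 st}.
move=> st [inp tree snk cnt0 hcut] fin; move: fin; rewrite [den (If _ _ _) _]den_if.
rewrite -[ev st (EV 11)]/(var st 11).
move=> [[z cl]|[found pn qn vp [vq Rpq]]].
  rewrite z eqxx den_skip; exists T; split; last by left.
  by split.
have -> : (var st 11 == 0) = false by lia.
have ncl : ~ closed (n * k) (arr st 1) (arr st 2).
  by move/(_ _ _ pn qn vp vq) => e; rewrite e in Rpq.
rewrite den_seq.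
set st2 := den mark_prog st.
have inp2 : input_ok n s t k E st2 by apply: (@input_den _ _ _ _ _ _ 0).
have m1 : arr st2 1 = arr st 1 by rewrite den_arr.
have m14 : var st2 14 = (var st 14).+1 by rewrite /st2 /mark_prog den_seq den_var // den_incr_var.
have m13 : var st2 13 = var st 13 by rewrite den_var.
have m2 : arr st2 2 = upd (arr st 2) (var st 13) (var st 14).+1.
  by rewrite /st2 /mark_prog !denE.
have m3 : arr st2 3 = upd (arr st 3) (var st 13) (var st 12).
  by rewrite /st2 /mark_prog !denE.
have tree2 : search_tree (n * k) k s (arr st2 1) (arr st2 2) (arr st2 3) (var st2 14).
  by rewrite m1 m2 m3 m14; apply: search_tree_extend.
have cntn : var st 14 <= n * k by case: tree => _ _ _ h; apply: leq_trans h (count_le _ _).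
rewrite den_if ev_eq -[ev st2 (EDiv _ _)]/(var st2 13 %/ var st2 1).
rewrite -[ev st2 (EV 4)]/(var st2 4).
have [[_ -> _] [_ -> _] _] := inp2; rewrite m13.
rewrite eqb0; case: ifP => [qt|/negbFE qt].
  rewrite den_skip; exists T; split; last by right; split=> //; rewrite m14; lia.
  split=> //; first by move=> p pn' pt; rewrite m2 /upd; case: eqP => [e|_]; [rewrite -e pt in qt|apply: snk].
  by rewrite m14.
rewrite den_seq; set st3 := den walk_prog st2.
have inp3 : input_ok n s t k E st3 by apply: (@input_den _ _ _ _ _ _ 0).
have [r1 r2 r3 r4 r5] := reset_ok inp3 sn st_ k0.
exists T.+1; split; last by right; split=> //; nia.
split=> // S vS; rewrite r2.
have := walk_ok inp2 st_ tree2 (S := S); rewrite -/st3 m13 => /(_ qn).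
by rewrite m2 /upd eqxx => /(_ isT qt vS); rewrite m1 => h; rewrite -hcut // -h; lia.
Qed.

Lemma flow_prog_ok n s t k E st S0 : s < n -> s != t -> 0 < k ->
  input_ok n s t k E st -> valid (n * k) k s t S0 ->
  cut (n * k) (arr st 1) S0 * (n * k).+1 + n * k < (n + size E + k).+1 ^ 9 ->
  let V := fun p => 0 < arr (den flow_prog st) 2 p in
  valid (n * k) k s t V /\
  forall S, valid (n * k) k s t S -> cut (n * k) (arr st 1) V <= cut (n * k) (arr st 1) S.
Proof.
move=> sn st_ k0 inp vS0 big V.
set C0 := cut (n * k) (arr st 1) in big *.
pose P i st' := exists T, flow_inv n s t k E C0 T st' /\
  (closed (n * k) (arr st' 1) (arr st' 2) \/ i <= progress n k T st').
have inp0 : input_ok n s t k E (den reset_prog st) by apply: (@input_den _ _ _ _ _ _ 0).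
have [T [[_ [h1 _ _ h2] snk _ hcut] fin]] : P ((n + size E + k).+1 ^ 9) (den flow_prog st).
  rewrite /flow_prog den_seq; apply: (@rep_ind _ _ 0).
  - by rewrite !big_cons big_nil; case: inp0 => _ [_ _ ->] _; rewrite !expnS expn0.
  - by [].
  - have [r1 r2 r3 r4 r5] := reset_ok inp sn st_ k0.
    by exists 0; split; [split=> // S _; rewrite r2 addn0 | right].
  move=> i st' _ _ [T [inv hi]].
  have [T' [inv' h]] := flow_body_ok sn st_ k0 inv; exists T'; split=> //.
  case: h => [cl|[ncl lt]]; first by left.
  by right; case: hi => // le; apply: leq_ltn_trans le lt.
have vV : valid (n * k) k s t V.
  by split=> p pn ps; [exact: h1|rewrite /V snk].
(* Otherwise the measure would reach the number of rounds, although T is at most the cut of [S0] and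
   the rank counter at most nk. *)
have cl : closed (n * k) (arr (den flow_prog st) 1) (arr (den flow_prog st) 2).
  case: fin => // h; exfalso; move: h; apply/negP; rewrite -ltnNge.
  apply: leq_trans big; rewrite ltnS /progress; apply: leq_add.
    by apply: leq_mul => //; rewrite -(hcut _ vS0) leq_addl.
  exact: leq_trans h2 (count_le _ _).
have c0 : cut (n * k) (arr (den flow_prog st) 1) V = 0.
  rewrite /cut big1 // => p _; rewrite big1 // => q _.
  case: (boolP (V p && ~~ V q)) => // /andP[vp]; rewrite /V -eqn0Ngt => /eqP vq.
  by rewrite cl.
by split=> // S vS; rewrite -(hcut _ vV) -(hcut _ vS) c0 leq_addl.
Qed.

(** * Output and resource bounds *)

(* Division by 0 gives 0, so a %/ (1 - b) is nonzero iff a > 0 and b = 0.  Row j of the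
   output is shifted by k|E| cells, out of reach of the copy to address 0. *)
Definition out_cell : com :=
  Put 4 (EAdd (EMul (EAdd (EV 1) (EV 10)) 2) (EV 8))
    (EDiv (EGet 2 (node_expr src_expr (EV 10)))
          (ESub (EC 1) (EGet 2 (node_expr dst_expr (EV 10))))).
Definition out_row : com := Seq (Asg 8 (EC 0)) (rep [:: 2] (Seq out_cell (incr 8))).
Definition out_prog : com :=
  Seq (Asg 10 (EC 0)) (rep [:: 1] (Seq out_row (incr 10))).

Lemma div_nz a b : (a %/ (1 - b) != 0) = (0 < a) && ~~ (0 < b).
Proof. by case: b => [|b]; rewrite ?divn1 ?divn0 ?andbT ?andbF ?lt0n. Qed.

Lemma out_prog_ok n s t k E st :
  input_ok n s t k E st ->
  let V := fun p => 0 < arr st 2 p in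
  forall j e, j < k -> e < size E ->
    (arr (den out_prog st) 4 (k * size E + (j * size E + e)) != 0) =
    V ((arc E e).1 * k + j) && ~~ V ((arc E e).2 * k + j).
Proof.
move=> inp V.
set M := size E.
pose spec (st' : store) j e :=
  (arr st' 4 (k * M + (j * M + e)) != 0) = V ((arc E e).1 * k + j) && ~~ V ((arc E e).2 * k + j).
pose base (st' : store) := input_ok n s t k E st' /\ arr st' 2 = arr st 2.
have basE c st' : wfc c 2 -> ~~ writes_arr c 0 -> ~~ writes_arr c 2 ->
    base st' -> base (den c st').
  by move=> w w0 w2 [b1 b2]; split; rewrite ?den_arr //; exact: (input_den w w0).
pose Q j e (st' : store) := [/\ base st', var st' 8 = e, var st' 10 = j &
  forall j' e', j' < k -> e' < M -> (j' < j) || (j' == j) && (e' < e) -> spec st' j' e'].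
have row j st' : j < k -> base st' -> var st' 10 = j ->
    (forall j' e', j' < k -> e' < M -> j' < j -> spec st' j' e') -> Q j M (den out_row st').
  move=> jk bs h10 h; rewrite /out_row den_seq.
  have bs0 := basE (Asg 8 (EC 0)) st' isT isT isT bs.
  apply: (@rep_ind _ _ 0).
  - by case: bs0 => -[[_ _ h2] _ _] _; rewrite big_cons big_nil muln1 h2.
  - by [].
  - split=> // j' e' jk' eM; rewrite ltn0 andbF orbF => jj.
    by rewrite /spec den_arr //; apply: h.
  move=> e st1 eM _ [bs1 h8 h101 h1].
  have bs3 := basE (Seq out_cell (incr 8)) st1 isT isT isT bs1.
  split=> //.
  - by rewrite den_seq den_incr_var den_var // h8.
  move=> j' e' jk' eM' hlt; rewrite /spec den_seq den_arr // /out_cell den_set.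
  set e1 := EAdd _ _; set e2 := EDiv _ _.
  rewrite -[arr (Store _ _) 4]/(upd (arr st1 4) (ev st1 e1) (ev st1 e2)).
  have [inp1 v1] := bs1.
  have hv1 : var st1 1 = k by case: inp1 => -[].
  have hv2 : var st1 2 = M by case: inp1 => -[].
  have -> : ev st1 e1 = k * M + (j * M + e).
    by rewrite /e1 /= hv1 hv2 h8 h101; lia.
  have -> : ev st1 e2 = arr st 2 ((arc E e).1 * k + j) %/ (1 - arr st 2 ((arc E e).2 * k + j)).
    rewrite -[ev st1 e2]/(arr st1 2 (ev st1 (node_expr src_expr (EV 10))) %/
       (1 - arr st1 2 (ev st1 (node_expr dst_expr (EV 10))))).
    by rewrite !(ev_node _ _ inp1) (ev_src inp1) ?h8 // (ev_dst inp1) ?h8 // v1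
      -[ev st1 (EV 10)]/(var st1 10) h101.
  rewrite /upd eqn_add2l idx_inj //.
  case: (eqVneq j' j) hlt => [->|nj] /=; last by rewrite orbF => lt; apply: h1; rewrite ?lt.
  case: (eqVneq e' e) => [->|ne] hlt; first by rewrite div_nz.
  by apply: h1 => //; rewrite eqxx /=; lia.
pose P j (st' : store) := [/\ base st', var st' 10 = j &
  forall j' e', j' < k -> e' < M -> j' < j -> spec st' j' e'].
suff [_ _ h] : P k (den out_prog st) by move=> j e jk eM; apply: h.
have bs0 : base (den (Asg 10 (EC 0)) st) by apply: basE.
rewrite /out_prog den_seq; apply: (@rep_ind _ _ 0).
- by case: bs0 => -[[_ h1 _] _ _] _; rewrite big_cons big_nil muln1 h1.
- by [].
- by split=> //; rewrite denE.
move=> j st' jk _ [bs h10 h].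
have bs3 := basE (Seq out_row (incr 10)) st' isT isT isT bs.
have [_ _ h10' h'] := row j st' jk bs h10 h.
split=> //; first by rewrite den_seq den_incr_var h10'.
move=> j' e' jk' eM hlt; rewrite /spec den_seq den_arr //; apply: h' => //.
by rewrite eM andbT orbC -leq_eqVlt.
Qed.

Lemma layered_cut_ext a k E S S' :
  (forall v i, i < k -> S v i = S' v i) -> layered_cut a k E S = layered_cut a k E S'.
Proof.
move=> h; apply: eq_bigr => e _; apply: eq_bigr => i _; apply: eq_bigr => j _.
by case: (ltnP (i + j) k) => // lt; rewrite !h.
Qed.

Lemma layered_cut_le a k E S c : (forall j, a j <= c) ->
  layered_cut a k E S <= size E * (k * (k * c)).
Proof.
move=> ac.
have sumc m (F : 'I_m -> nat) x : (forall i, F i <= x) -> \sum_i F i <= m * x.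
  by move=> h; rewrite -[in m * x](card_ord m) -sum_nat_const; apply: leq_sum.
do 3!apply: (sumc) => ?.
by case: (_ < k); case: (_ && _); rewrite ?mul1n ?muln1 ?muln0.
Qed.

Definition main_prog (w : expr) : com :=
  Seq zero_prog (Seq (build_prog w) (Seq flow_prog out_prog)).

(** The cut is at most X^3 X^3 and nk + 1 at most X^2, which gives X^8; the summand nk costs a
    factor 2 <= X, hence the exponent 9. *)
Lemma flow_rounds n M k c : 0 < n -> 0 < k -> c <= M * (k * (k * (M * k * k + 1))) ->
  c * (n * k).+1 + n * k < (n + M + k).+1 ^ 9.
Proof.
move=> n0 k0 hc; set X := (n + M + k).+1.
have h1 : M * (k * (k * (M * k * k + 1))) <= X ^ 3 * X ^ 3.
  rewrite mulnA mulnA; apply: leq_mul.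
    by rewrite !expnS expn0 muln1 mulnA; do !apply: leq_mul; rewrite /X; lia.
  rewrite addn1 !expnS expn0 muln1.
  apply: (@leq_ltn_trans (M * (k * k))); first by rewrite mulnA.
  by apply: ltn_mul; [rewrite /X; lia | apply: ltn_mul; rewrite /X; lia].
have h2 : n * k < X ^ 2.
  by rewrite expnS expn1; apply: ltn_mul; rewrite /X; lia.
have h3 : c * (n * k).+1 <= X ^ 8.
  by rewrite (_ : 8 = 3 + 3 + 2) // !expnD; apply: leq_mul => //; apply: leq_trans hc h1.
have h4 : X ^ 2 <= X ^ 8 by rewrite leq_pexp2l.
have X2 : 2 <= X by rewrite /X; lia.
apply: (@leq_trans (2 * X ^ 8)); last by rewrite expnS leq_mul2r X2 orbT.
by rewrite mul2n -addnn -addnS; apply: leq_add => //; apply: leq_trans h4.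
Qed.

Lemma main_prog_ok n s t k E st w W : weight_expr w W ->
  (forall M k j, W M k j <= M * k * k + 1) ->
  valid_instance n s t k E -> input_ok n s t k E st ->
  exists S : nat -> nat -> bool,
  [/\ forall i, i < k -> S s i, forall i, i < k -> ~~ S t i,
      forall S' : nat -> nat -> bool,
       (forall i, i < k -> S' s i) -> (forall i, i < k -> ~~ S' t i) ->
       layered_cut (W (size E) k) k E S <= layered_cut (W (size E) k) k E S' &
      forall j e, j < k -> e < size E ->
       (arr (den (main_prog w) st) 4 (k * size E + (j * size E + e)) != 0) =
       S (arc E e).1 j && ~~ S (arc E e).2 j].
Proof.
move=> wW Wle [sn tn st_ k0 [_ allE]] inp; have [ww _] := wW.
rewrite /main_prog 3!den_seq.
set st1 := den zero_prog st.
have inp1 : input_ok n s t k E st1 by apply: (@input_den _ _ _ _ _ _ 0).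
set st2 := den (build_prog w) st1.
have inp2 : input_ok n s t k E st2.
  by apply: (@input_den _ _ _ _ _ _ 0) => //; rewrite /= ww.
have hcut S : cut (n * k) (arr st2 1) S =
    layered_cut (W (size E) k) k E (fun v i => S (v * k + i)).
  by rewrite (build_prog_ok _ wW allE inp1) (zero_ok _ inp).
have inp3 : input_ok n s t k E (den flow_prog st2) by apply: (@input_den _ _ _ _ _ _ 0).
(* The copies of s alone form a valid set, whose cut limits the number of augmentations. *)
have vS0 : valid (n * k) k s t (fun p => p %/ k == s).
  by split=> // p _ /eqP->; rewrite eq_sym.
have big : cut (n * k) (arr st2 1) (fun p => p %/ k == s) * (n * k).+1 + n * k <
    (n + size E + k).+1 ^ 9.
  apply: flow_rounds => //; first by lia.
  by rewrite hcut; apply: layered_cut_le => j; apply: Wle.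
have [vV minV] := flow_prog_ok sn st_ k0 inp2 vS0 big.
exists (fun v i => 0 < arr (den flow_prog st2) 2 (v * k + i)).
have node v i : v < n -> i < k -> v * k + i < n * k /\ (v * k + i) %/ k = v.
  by move=> vn ik; split; [exact: node_lt | rewrite divnMDl // divn_small // addn0].
split.
- by move=> i ik; have [h1 h2] := node s i sn ik; apply: vV.1; rewrite ?h2.
- by move=> i ik; have [h1 h2] := node t i tn ik; apply: vV.2; rewrite ?h2.
- move=> S' S's S't.
  have ext : layered_cut (W (size E) k) k E S' =
      cut (n * k) (arr st2 1) (fun p => S' (p %/ k) (p %% k)).
    rewrite hcut; apply: layered_cut_ext => v i ik.
    by rewrite divnMDl // divn_small // addn0 modnMDl modn_small.
  rewrite ext -(hcut (fun p => 0 < arr (den flow_prog st2) 2 p)); apply: minV.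
  by split=> p _ /eqP->; [apply: S's | apply: S't]; rewrite ltn_mod.
- by move=> j e jk eE; rewrite (out_prog_ok inp3).
Qed.

Lemma code_at_mid a b c : code_at (a ++ b ++ c) (size a) b.
Proof.
by move=> i ib; rewrite nth_cat ltnNge leq_addr /= addKn nth_cat ib.
Qed.

Lemma decode_layered_sol E k (S : nat -> nat -> bool) (m : nat -> nat) :
  (forall j e, j < k -> e < size E ->
    (m (j * size E + e) != 0) = S (arc E e).1 j && ~~ S (arc E e).2 j) ->
  decode E k m = layered_sol k E S.
Proof.
move=> h; apply/eq_in_map => j; rewrite mem_iota add0n => /andP[_ jk].
by apply/setP => e; rewrite !inE h.
Qed.

Definition whole_prog (w : expr) : program :=
  let l := size prologue in
  let k := ccom (main_prog w) 0 l in
  prologue ++ k ++ epilogue (l + size k).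

(** The growth factor [G] dominates every second factor, namely n^2 in the packing and read-only
    variables, at most N + 1, in loop code, as well as all constants of the program. *)
Lemma whole_prog_ok n s t k E w W :
  weight_expr w W -> (forall M k j, W M k j <= M * k * k + 1) ->
  valid_instance n s t k E ->
  let N := n + size E + k in
  let G := N.+1 * N.+1 + 1000 in
  exists T st' (S : nat -> nat -> bool),
  [/\ steps G (whole_prog w) (init_state (encode n s t k E)) T st',
      halted (whole_prog w) st',
      T <= 450 + 14 * size E + 7 * (k * size E) + (N + 7) ^ weight (main_prog w),
      decode E k (mem st') = layered_sol k E S &
      [/\ forall i, i < k -> S s i, forall i, i < k -> ~~ S t i &
      forall S' : nat -> nat -> bool,
       (forall i, i < k -> S' s i) -> (forall i, i < k -> ~~ S' t i) ->
       layered_cut (W (size E) k) k E S <= layered_cut (W (size E) k) k E S']].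
Proof.
move=> wW Wle vi N G; have [ww _] := wW; have [sn tn _ _ _] := vi.
set P := whole_prog w; set l := size prologue; set cm := ccom (main_prog w) 0 l.
have G1 : 1000 <= G by rewrite /G; lia.
have nG : n * n <= G by rewrite /G; nia.
have code1 : code_at P 0 prologue by exact: (@code_at_mid [::]).
have code2 : code_at P l cm by exact: code_at_mid.
have code3 : code_at P (l + size cm) (epilogue (l + size cm)).
  have := @code_at_mid (prologue ++ cm) (epilogue (l + size cm)) [::].
  by rewrite cats0 size_cat -catA.
have [m1 [T1 [st1 le1 inp]]] := prologue_ok vi G1 nG code1.
have wf : wfc (main_prog w) 0 by rewrite /= ww.
have sm : sim (store_of m1) m1 by [].
have ro x : x < 6 -> var (store_of m1) x <= N.+1.
  case: inp => -[h0 h1 h2] [h3 h4 h5] _.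
  by case: x => [|[|[|[|[|[|x]]]]]] // _; rewrite ?h0 ?h1 ?h2 ?h3 ?h4 ?h5 /N; lia.
have LG : N.+1 <= G by rewrite /G; nia.
have G100 : 100 <= G by lia.
have [T2 [m2 [st2 le2 sm2 _]]] := ccom_ok G100 LG (leq0n 24) code2 wf sm ro.
have [S [S1 S2 S3 S4]] := main_prog_ok wW Wle vi inp.
have MG : size E <= G by rewrite /G /N; nia.
have hk : var (den (main_prog w) (store_of m1)) 1 = k.
  by rewrite (den_ro _ wf) //; case: inp => -[].
have hM : var (den (main_prog w) (store_of m1)) 2 = size E.
  by rewrite (den_ro _ wf) //; case: inp => -[].
have [m3 [T3 [st3 hlt le3 out]]] := epilogue_ok G1 MG code3 sm2 hk hM.
exists (T1 + (T2 + T3)), m3, S; split=> //.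
- apply: (steps_trans _ st1); first by lia.
  by apply: (steps_trans _ st2) st3; lia.
- have := leq_trans le2 (time_le _ _); rewrite addSnnS; lia.
- by apply: decode_layered_sol => j e jk eE; rewrite out ?S4 //; nia.
Qed.

Lemma time_poly wt : exists A B, forall n M k,
  450 + 14 * M + 7 * (k * M) + (n + M + k + 7) ^ wt <= A * (n + M + k).+1 ^ B.
Proof.
(* Here 471 = 450 + 14 + 7, and 7 ^ wt comes from N + 7 <= 7 (N + 1). *)
exists (471 + 7 ^ wt), (wt + 2) => n M k; set N := n + M + k.
have h1 : (N + 7) ^ wt <= 7 ^ wt * N.+1 ^ wt.
  by rewrite -expnMn; case: (posnP wt) => [->//|wt0]; rewrite leq_exp2r //; lia.
have h2 : 450 + 14 * M + 7 * (k * M) <= 471 * N.+1 ^ 2.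
  by rewrite expnS expn1 /N; nia.
have p1 : 0 < N.+1 ^ wt by rewrite expn_gt0.
have p2 : 0 < N.+1 ^ 2 by [].
rewrite mulnDl expnD; apply: leq_add.
  apply: leq_trans h2 _; rewrite leq_mul2l; apply/orP; right.
  by rewrite leq_pmull.
apply: leq_trans h1 _; rewrite leq_mul2l; apply/orP; right.
by rewrite leq_pmulr.
Qed.

Lemma init_bounded n s t k E : valid_instance n s t k E ->
  bounded (n + size E + k).+1 (mem (init_state (encode n s t k E))).
Proof.
move=> [sn tn _ _ [_ /allP allE]] a; rewrite /init_state /=.
case: a => [|[|[|[|[|a]]]]] /=; try lia.
have [lt|ge] := ltnP a (size (flatten [seq [:: e.1; e.2] | e <- E])); last by rewrite nth_default.
have /flattenP[_ /mapP[e eE ->]] := mem_nth 0 lt.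
by have /andP[h1 h2] := allE _ eE; rewrite !inE => /orP[/eqP->|/eqP->]; lia.
Qed.

Lemma solvable_by (d : diversity) w W :
  weight_expr w W -> (forall M k j, W M k j <= M * k * k + 1) ->
  (forall E s t k (S : nat -> nat -> bool), 0 < k -> s != t ->
    (forall i, i < k -> S s i) -> (forall i, i < k -> ~~ S t i) ->
    (forall S' : nat -> nat -> bool,
      (forall i, i < k -> S' s i) -> (forall i, i < k -> ~~ S' t i) ->
      layered_cut (W (size E) k) k E S <= layered_cut (W (size E) k) k E S') ->
    optimal_dmc d s t k (layered_sol k E S)) ->
  strongly_poly_solvable d.
Proof.
move=> wW Wle opt.
have [A [B hAB]] := time_poly (weight (main_prog w)).
(* One constant is coefficient and exponent of both bounds. Memory stays at most X G^T < 2 ^ (X + G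
   T), and G <= 1001 X^2, so (2 + 1001 A) X^(B + 2) bits suffice. *)
exists (whole_prog w), (2 + 1001 * A + (B + 2)); move=> n s t k E vi N st0.
have [T [st' [S [[hrun hbnd] hlt hT hdec [S1 S2 S3]]]]] := whole_prog_ok wW Wle vi.
have [_ _ st_ k0 _] := vi.
have Tle : T <= A * N.+1 ^ B by apply: leq_trans hT (hAB _ _ _).
set X := N.+1 in Tle *.
have X0 : 0 < X by [].
have powc b c e : b <= c -> e <= c -> b * X ^ e <= c * X ^ c.
  by move=> bc ec; apply: leq_mul => //; apply: leq_pexp2l.
exists T; split.
- by apply: leq_trans Tle _; apply: powc; lia.
- by rewrite hrun.
- move=> j a jT.
  have := hbnd j X jT X0 (init_bounded vi) a; rewrite -/st0 => h.
  apply: leq_ltn_trans h _.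
  set G := X * X + 1000.
  have G0 : 0 < G by rewrite /G; lia.
  apply: (@leq_ltn_trans (X * G ^ T)).
    by rewrite leq_mul2l leq_pexp2l ?orbT.
  apply: (@leq_trans (2 ^ (X + G * T))).
    rewrite expnD expnM; apply: (@leq_trans (2 ^ X * G ^ T)).
      by rewrite ltn_mul2r expn_gt0 G0 /=; apply: ltn_expl.
    rewrite leq_mul2l; apply/orP; right; case: (posnP T) => [->//|T0].
    by rewrite leq_exp2r //; apply/ltnW/ltn_expl.
  apply: leq_pexp2l => //.
  apply: (@leq_trans ((2 + 1001 * A) * X ^ (B + 2))); last by apply: powc; lia.
  have hG : G <= 1001 * X ^ 2 by rewrite /G !expnS expn0; nia.
  have hX : X <= 2 * X ^ (B + 2).
    by rewrite addn2 expnS mulnCA leq_pmulr // muln_gt0 expn_gt0 X0.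
  rewrite mulnDl; apply: leq_add => //.
  apply: leq_trans (leq_mul hG Tle) _.
  by rewrite expnD; nia.
- by rewrite hrun hdec; apply: opt.
Qed.

Lemma w_sum_le m k j : w_sum m k j <= m * k * k + 1.
Proof. by rewrite /w_sum; case: j => [|j]; rewrite ?subn0 ?mul1n // subSS sub0n !mul0n; lia. Qed.

Lemma w_cov_le m k j : w_cov m k j <= m * k * k + 1.
Proof.
by rewrite /w_cov; case: j => [|j]; rewrite ?subn0 ?mul1n // (_ : 1 - j.+1 = 0) //; lia.
Qed.

Theorem theorem1 :
  strongly_poly_solvable d_sum /\ strongly_poly_solvable d_cov.
Proof.
split.
- apply: (solvable_by w_sum_exprP w_sum_le) => *; exact: layered_sum_optimal.
- apply: (solvable_by w_cov_exprP w_cov_le) => *; exact: layered_cov_optimal.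
Qed.
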